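(* Let $(H,\alpha)$ be a monoidal Hom-Hopf algebra, let $(B,\beta)$ be a right $(H,\alpha)$-Hom-comodule algebra, and let $A=B^{coH}$. Then $A\subset B$ is an $H$-cleft extension if and only if $B\cong A\#_{\sigma}H$ for some crossed product $A\#_{\sigma}H$ of $A$ with $H$, where $\cong$ means that there is a bijective Hom-algebra map $A\#_\sigma H\to B$ which is both a left $A$-module map and a right $H$-comodule map.
   Context: All vector spaces, tensor products and linear maps are over a fixed field $k$. Sweedler notation: $\Delta(h)=\sum h_1\otimes h_2$, $\sum h_1\otimes\Delta(h_2)=\sum h_1\otimes h_{21}\otimes h_{22}$, etc. A Hom-algebra $(A,\beta)$ is a vector space $A$ with a linear automorphism $\beta$, an element $1\in A$ and a linear map $A\otimes A\to A$, $a\otimes b\mapsto ab$, such that $\beta(a)(bc)=(ab)\beta(c)$, $a1=\beta(a)=1a$, $\beta(ab)=\beta(a)\beta(b)$, $\beta(1)=1$; the element $1$ is called the identity. A Hom-algebra map is a linear map commuting with the automorphisms and preserving products and identities. The tensor product of Hom-algebras is a Hom-algebra with componentwise product and the tensor product automorphism. A Hom-coalgebra $(C,\gamma)$ is a vector space with a linear automorphism $\gamma$ and linear maps $\Delta:C\to C\otimes C$, $\varepsilon:C\to k$ such that $\sum\gamma^{-1}(c_1)\otimes\Delta(c_2)=\sum\Delta(c_1)\otimes\gamma^{-1}(c_2)$, $\sum c_1\varepsilon(c_2)=\sum\varepsilon(c_1)c_2=\gamma^{-1}(c)$, $\Delta(\gamma(c))=\sum\gamma(c_1)\otimes\gamma(c_2)$,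 $\varepsilon(\gamma(c))=\varepsilon(c)$. A monoidal Hom-Hopf algebra $(H,\alpha)$ is a vector space with linear automorphism $\alpha$ that is both a Hom-algebra and a Hom-coalgebra, with $\Delta(gh)=\Delta(g)\Delta(h)$, $\Delta(1)=1\otimes1$, $\varepsilon(gh)=\varepsilon(g)\varepsilon(h)$, $\varepsilon(1)=1$, and with a linear map $S:H\to H$ such that $S\circ\alpha=\alpha\circ S$ and $\sum S(h_1)h_2=\varepsilon(h)1=\sum h_1S(h_2)$. A left $(A,\beta)$-Hom-module is a vector space $M$ with linear automorphism $\mu$ and a linear map $A\otimes M\to M$, $a\otimes m\mapsto am$, with $\beta(a)(bm)=(ab)\mu(m)$, $1m=\mu(m)$, $\mu(am)=\beta(a)\mu(m)$. Left $A$-module maps are linear maps commuting with the action and with the automorphisms. A right $(H,\alpha)$-Hom-comodule is a vector space $M$ with linear automorphism $\mu$ and a linear map $\rho:M\to M\otimes H$, $m\mapsto\sum m_{(0)}\otimes m_{(1)}$, with $\sum\mu^{-1}(m_{(0)})\otimes\Delta(m_{(1)})=\sum\rho(m_{(0)})\otimes\alpha^{-1}(m_{(1)})$, $\sum\varepsilon(m_{(1)})m_{(0)}=\mu^{-1}(m)$, $\rho(\mu(m))=\sum\mu(m_{(0)})\otimes\alpha(m_{(1)})$. Right $H$-comodule maps $g:M\to N$ are linear maps commuting with the automorphisms and satisfying $\rho_N\circ g=(g\otimes id)\circ\rho_M$. $H$ is a right $H$-comodule via $\Delta$. A right $(H,\alpha)$-Hom-comodule algebra is a Hom-algebra $(B,\beta)$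 with a right $(H,\alpha)$-Hom-comodule structure $\rho:B\to B\otimes H$ that is a Hom-algebra map. Its coinvariants are $B^{coH}=\{b\in B:\rho(b)=\beta^{-1}(b)\otimes 1\}$, a Hom-algebra with the restriction of $\beta$; $B$ is a left $A=B^{coH}$-module by multiplication. Cleft extension: $A=B^{coH}\subset B$ is $H$-cleft if there is a right $H$-comodule map $\gamma:H\to B$ which is convolution invertible, i.e. there is a linear $\gamma^{-1}:H\to B$ with $\sum\gamma(h_1)\gamma^{-1}(h_2)=\varepsilon(h)1=\sum\gamma^{-1}(h_1)\gamma(h_2)$. Weak action: $H$ weakly acts on $A$ if there is a linear map $H\otimes A\to A$, $h\otimes a\mapsto h\cdot a$, with $\beta(h\cdot a)=\alpha(h)\cdot\beta(a)$, $h\cdot1=\varepsilon(h)1$, $h\cdot(ab)=\sum(h_1\cdot a)(h_2\cdot b)$. Crossed product: given a weak action of $H$ on $A$ and a convolution invertible linear map $\sigma:H\otimes H\to A$ (i.e. there is a linear $\sigma^{-1}$ with $\sum\sigma(h_1,l_1)\sigma^{-1}(h_2,l_2)=\varepsilon(h)\varepsilon(l)1=\sum\sigma^{-1}(h_1,l_1)\sigma(h_2,l_2)$), $A\#_\sigma H$ is the vector space $A\otimes H$ (elements $a\#h$) with multiplication $$(a\#h)(b\#k)=\sum a[(\alpha^{-1}(h_{1})\cdot\beta^{-2}(b))\sigma(h_{21},\alpha^{-1}(k_{1}))]\#\alpha^{2}(h_{22})\alpha(k_{2}),$$ and it is required that $(A\#_\sigma H,\beta\otimes\alpha)$ is a Hom-algebra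 with identity $1\#1$. Its left $A$-action is $a\cdot(b\#h)=\beta^{-1}(a)b\#\alpha(h)$ and its right $H$-coaction is $a\#h\mapsto\sum(\beta^{-1}(a)\#h_1)\otimes\alpha(h_2)$. *)

(* Defs.v *)
From HB Require Import structures.
From mathcomp Require Import all_boot all_algebra.
From mathcomp Require Import boolp.

Set Implicit Arguments.
Unset Strict Implicit.
Unset Printing Implicit Defensive.

Import GRing.Theory.
Local Open Scope ring_scope.
Local Open Scope quotient_scope.

Reserved Notation "M \Ox N" (at level 40, left associativity).
Reserved Notation "x \ox y" (at level 40, left associativity).
Reserved Notation "a *h b" (at level 40, left associativity).
Reserved Notation "\sw_ ( x , y <- t ) E"
  (at level 41, E at level 41, x name, y name, t at level 200,
   format "\sw_ ( x ,  y  <-  t )  E").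

(* The tensor product of two vector spaces: formal sums of pairs (the scalars *)
(* being absorbed in the pairs), two of them being identified when no         *)
(* bilinear map separates them. The lemmas tens_bilinear, tensor_ind and      *)
(* tliftE state the universal property.                                       *)
Section TensorSpace.
Variables (k : fieldType) (M N : lmodType k).


Definition tens_equiv (s t : seq (M * N)) : bool :=
  `[< forall (P : lmodType k) (f : {bilinear M -> N -> P}),
        \sum_(p <- s) f p.1 p.2 = \sum_(p <- t) f p.1 p.2 >].

Lemma tens_equivP (s t : seq (M * N)) :
  reflect (forall (P : lmodType k) (f : {bilinear M -> N -> P}),
    \sum_(p <- s) f p.1 p.2 = \sum_(p <- t) f p.1 p.2) (tens_equiv s t).
Proof. exact: asboolP. Qed.

Lemma tens_equiv_refl : reflexive tens_equiv.
Proof. by move=> s; apply/tens_equivP. Qed.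

Lemma tens_equiv_sym : symmetric tens_equiv.
Proof. by move=> s t; apply/tens_equivP/tens_equivP => E P f; rewrite E. Qed.

Lemma tens_equiv_trans : transitive tens_equiv.
Proof.
by move=> s t u /tens_equivP E /tens_equivP F; apply/tens_equivP => P f;
  rewrite E F.
Qed.

Canonical tens_equiv_rel :=
  EquivRel tens_equiv tens_equiv_refl tens_equiv_sym tens_equiv_trans.

Record tensor : Type := Tensor { tensor_class : {eq_quot tens_equiv} }.

Lemma tensor_classK : cancel tensor_class Tensor. Proof. by case. Qed.

HB.instance Definition _ := Choice.copy tensor (can_type tensor_classK).

Definition tensor_of (s : seq (M * N)) : tensor :=
  Tensor (\pi_({eq_quot tens_equiv}) s).
Definition tensor_repr (t : tensor) : seq (M * N) := repr (tensor_class t).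

Lemma tensor_reprK (t : tensor) : tensor_of (tensor_repr t) = t.
Proof. by rewrite /tensor_of reprK tensor_classK. Qed.

Lemma tensor_ofP s t : tensor_of s = tensor_of t <-> tens_equiv s t.
Proof. by split=> [[/eqmodP]|E] //; congr Tensor; apply/eqmodP. Qed.

Lemma repr_sum s (P : lmodType k) (f : {bilinear M -> N -> P}) :
  \sum_(p <- tensor_repr (tensor_of s)) f p.1 p.2 = \sum_(p <- s) f p.1 p.2.
Proof.
have /tensor_ofP/tens_equivP := tensor_reprK (tensor_of s).
exact.
Qed.

Lemma tensorP (t u : tensor) :
  (forall (P : lmodType k) (f : {bilinear M -> N -> P}),
    \sum_(p <- tensor_repr t) f p.1 p.2 = \sum_(p <- tensor_repr u) f p.1 p.2) ->
  t = u.
Proof.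
move=> E; rewrite -[t]tensor_reprK -[u]tensor_reprK.
by apply/tensor_ofP/tens_equivP.
Qed.

Definition tensor_zero := tensor_of [::].
Definition tensor_add t u := tensor_of (tensor_repr t ++ tensor_repr u).
Definition tensor_scale c t :=
  tensor_of [seq (c *: p.1, p.2) | p <- tensor_repr t].
Definition tensor_opp t := tensor_scale (-1) t.
Definition tens (x : M) (y : N) := tensor_of [:: (x, y)].

Lemma repr_add t u (P : lmodType k) (f : {bilinear M -> N -> P}) :
  \sum_(p <- tensor_repr (tensor_add t u)) f p.1 p.2
  = \sum_(p <- tensor_repr t) f p.1 p.2 + \sum_(p <- tensor_repr u) f p.1 p.2.
Proof. by rewrite repr_sum big_cat. Qed.

Lemma repr_zero (P : lmodType k) (f : {bilinear M -> N -> P}) :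
  \sum_(p <- tensor_repr tensor_zero) f p.1 p.2 = 0.
Proof. by rewrite repr_sum big_nil. Qed.

Lemma repr_scale c t (P : lmodType k) (f : {bilinear M -> N -> P}) :
  \sum_(p <- tensor_repr (tensor_scale c t)) f p.1 p.2
  = c *: \sum_(p <- tensor_repr t) f p.1 p.2.
Proof.
by rewrite repr_sum big_map scaler_sumr; apply: eq_bigr => p _; rewrite linearZl_LR.
Qed.

Definition repr_simp := (repr_add, repr_zero, repr_scale).

Lemma tensor_addA : associative tensor_add.
Proof. by move=> t u v; apply: tensorP => P f; rewrite !repr_simp addrA. Qed.

Lemma tensor_addC : commutative tensor_add.
Proof. by move=> t u; apply: tensorP => P f; rewrite !repr_simp addrC. Qed.

Lemma tensor_add0 : left_id tensor_zero tensor_add.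
Proof. by move=> t; apply: tensorP => P f; rewrite !repr_simp add0r. Qed.

Lemma tensor_addN : left_inverse tensor_zero tensor_opp tensor_add.
Proof.
by move=> t; apply: tensorP => P f; rewrite !repr_simp scaleN1r addNr.
Qed.

HB.instance Definition _ := GRing.isZmodule.Build tensor
  tensor_addA tensor_addC tensor_add0 tensor_addN.

Lemma tensor_scaleA c d t :
  tensor_scale c (tensor_scale d t) = tensor_scale (c * d) t.
Proof. by apply: tensorP => P f; rewrite !repr_simp scalerA. Qed.

Lemma tensor_scale1 : left_id 1 tensor_scale.
Proof. by move=> t; apply: tensorP => P f; rewrite !repr_simp scale1r. Qed.

Lemma tensor_scaleDr : right_distributive tensor_scale +%R.
Proof. by move=> c t u; apply: tensorP => P f; rewrite !repr_simp scalerDr. Qed.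

Lemma tensor_scaleDl t : {morph tensor_scale^~ t : c d / c + d}.
Proof. by move=> c d; apply: tensorP => P f; rewrite !repr_simp scalerDl. Qed.

HB.instance Definition _ := GRing.Zmodule_isLmodule.Build k tensor
  tensor_scaleA tensor_scale1 tensor_scaleDr tensor_scaleDl.

Lemma repr_addE (t u : tensor) (P : lmodType k) (f : {bilinear M -> N -> P}) :
  \sum_(p <- tensor_repr (t + u)) f p.1 p.2
  = \sum_(p <- tensor_repr t) f p.1 p.2 + \sum_(p <- tensor_repr u) f p.1 p.2.
Proof. exact: repr_add. Qed.

Lemma repr_scaleE c (t : tensor) (P : lmodType k) (f : {bilinear M -> N -> P}) :
  \sum_(p <- tensor_repr (c *: t)) f p.1 p.2
  = c *: \sum_(p <- tensor_repr t) f p.1 p.2.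
Proof. exact: repr_scale. Qed.

Lemma tens_bilinear : bilinear_for *:%R *:%R tens.
Proof.
split=> [y c x x'|x c y y']; apply: tensorP => P f;
  rewrite repr_addE repr_scaleE !repr_sum !big_seq1 /=.
- by rewrite linearPl.
- by rewrite linearPr.
Qed.

Lemma tensor_sum (t : tensor) : t = \sum_(p <- tensor_repr t) tens p.1 p.2.
Proof.
rewrite -[LHS]tensor_reprK; elim: (tensor_repr t) => [|p s IHs].
  by rewrite big_nil.
rewrite big_cons -IHs; apply: tensorP => P f.
by rewrite repr_addE !repr_sum big_cons big_seq1.
Qed.

Lemma tensor_ind (K : tensor -> Prop) :
  (forall x y, K (tens x y)) -> (forall t u, K t -> K u -> K (t + u)) ->
  forall t, K t.
Proof.
move=> Kt KD t; rewrite [t]tensor_sum.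
have K0 : K 0.
  suff <- : tens 0 0 = 0 by exact: Kt.
  have /= := tens_bilinear.1 0 (-1) 0 0.
  by rewrite !scaleN1r oppr0 addr0 addNr.
by elim: (tensor_repr t) => [|p s IHs]; rewrite ?big_nil // big_cons; apply: KD.
Qed.

End TensorSpace.

Notation "M \Ox N" := (tensor M N) : type_scope.
Notation "M \Ox N" := (tensor M N) : ring_scope.
Notation "x \ox y" := (tens x y) : ring_scope.

(* Sweedler notation. The sum ranges over a chosen decomposition of t into    *)
(* pure tensors; it does not depend on the choice as long as E is bilinear in *)
(* (x, y), see sweedlerE and linear_sw.                                       *)
Definition sweedler (k : fieldType) (M N P : lmodType k) (f : M -> N -> P)
    (t : M \Ox N) : P := \sum_(p <- tensor_repr t) f p.1 p.2.

Notation "\sw_ ( x , y <- t ) E" := (sweedler (fun x y => E) t) : ring_scope.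

Section Linearity.
Variable k : fieldType.
Implicit Types (L M N P : lmodType k).

Lemma linear_id M : linear (fun z : M => z).
Proof. by []. Qed.

Lemma linear_app L M N (g : {linear M -> N}) (f : L -> M) :
  linear f -> linear (fun z => g (f z)).
Proof. by move=> lf c x y; rewrite lf linearP. Qed.

Lemma linear_scalel L M (g : {scalar L}) (m : M) :
  linear (fun z => g z *: m).
Proof. by move=> c x y; rewrite linearP scalerDl scalerA. Qed.

Lemma linear_tensl L M N (f : L -> M) (y : N) :
  linear f -> linear (fun z => f z \ox y).
Proof. by move=> lf c u v; rewrite lf; apply: (tens_bilinear M N).1. Qed.

Lemma linear_tensr L M N (x : M) (f : L -> N) :
  linear f -> linear (fun z => x \ox f z).
Proof. by move=> lf c u v; rewrite lf; apply: (tens_bilinear M N).2. Qed.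

Lemma linear_sw L M N P (f : M -> N -> P) (t : L -> M \Ox N) :
  (forall y, linear (f^~ y)) -> (forall x, linear (f x)) -> linear t ->
  linear (fun z => \sw_(x, y <- t z) f x y).
Proof.
move=> fl fr lt c u v; rewrite lt.
pose g : {bilinear M -> N -> P} :=
  HB.pack f (bilinear_isBilinear.Build k M N P *:%R *:%R f (fl, fr)).
by rewrite /sweedler (repr_addE _ _ g) (repr_scaleE _ _ g).
Qed.

Lemma linear_sw_body L M N P (f : L -> M -> N -> P) (t : M \Ox N) :
  (forall x y, linear (fun z => f z x y)) ->
  linear (fun z => \sw_(x, y <- t) f z x y).
Proof.
move=> fl c u v; rewrite /sweedler scaler_sumr -big_split /=.
by apply: eq_bigr => p _; rewrite fl.
Qed.

Lemma sweedlerE M N P (f : M -> N -> P) a b :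
  (forall y, linear (f^~ y)) -> (forall x, linear (f x)) ->
  \sw_(x, y <- a \ox b) f x y = f a b.
Proof.
move=> fl fr.
pose g : {bilinear M -> N -> P} :=
  HB.pack f (bilinear_isBilinear.Build k M N P *:%R *:%R f (fl, fr)).
by rewrite /sweedler (repr_sum _ g) big_seq1.
Qed.

End Linearity.

Ltac solve_linear :=
  intros; cbv beta;
  lazymatch goal with
  | |- context [fun z => z] => first [exact: linear_id | solve_linear_step]
  | |- _ => solve_linear_step
  end
with solve_linear_step :=
  first
  [ assumption
  | apply: linear_sw; solve_linear
  | apply: linear_sw_body; solve_linear
  | apply: linear_tensl; solve_linear
  | apply: linear_tensr; solve_linear
  | apply: linear_app; solve_linear
  | apply: linear_scalel ].

Section TensorMaps.
Variable k : fieldType.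
Implicit Types (L M N P : lmodType k).

Section Lift.
Variables (M N P : lmodType k) (f : M -> N -> P).
Hypotheses (fl : forall y, linear (f^~ y)) (fr : forall x, linear (f x)).

Definition tlift_fun of (forall y, linear (f^~ y)) & (forall x, linear (f x)) :=
  fun t : M \Ox N => \sw_(x, y <- t) f x y.

Lemma tlift_linear : linear (tlift_fun fl fr).
Proof. by apply: linear_sw. Qed.

HB.instance Definition _ :=
  GRing.isLinear.Build k (M \Ox N) P *:%R (tlift_fun fl fr) tlift_linear.

Definition tlift : {linear M \Ox N -> P} := tlift_fun fl fr.

Lemma tliftE x y : tlift (x \ox y) = f x y.
Proof. exact: sweedlerE. Qed.

End Lift.

Lemma tensor_ext M N P (f g : M \Ox N -> P) :
  linear f -> linear g -> (forall x y, f (x \ox y) = g (x \ox y)) -> f =1 g.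
Proof.
move=> lf lg E; elim/tensor_ind => // t u Et Eu.
by have := lf 1 t u; have := lg 1 t u; rewrite !scale1r Et Eu => -> ->.
Qed.

Section Tmap.
Variables (M N M' N' : lmodType k).
Variables (f : {linear M -> M'}) (g : {linear N -> N'}).

Lemma tmapl y : linear (fun x => f x \ox g y). Proof. solve_linear. Qed.
Lemma tmapr x : linear (fun y => f x \ox g y). Proof. solve_linear. Qed.

Definition tmap : {linear M \Ox N -> M' \Ox N'} := tlift tmapl tmapr.

Lemma tmapE x y : tmap (x \ox y) = f x \ox g y.
Proof. exact: tliftE. Qed.

End Tmap.

End TensorMaps.

(* Vector spaces with a linear automorphism haut, whose inverse is hautV. *)
HB.mixin Record Lmodule_isHomSpace (k : fieldType) V of GRing.Lmodule k V := {
  haut : {linear V -> V};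
  hautV : {linear V -> V};
  hautK : cancel haut hautV;
  hautVK : cancel hautV haut
}.

#[short(type="homSpaceType")]
HB.structure Definition HomSpace (k : fieldType) :=
  {V of GRing.Lmodule k V & Lmodule_isHomSpace k V}.

Section TensorHomSpace.
Variables (k : fieldType) (V W : homSpaceType k).

Definition tens_haut : {linear V \Ox W -> V \Ox W} := tmap haut haut.
Definition tens_hautV : {linear V \Ox W -> V \Ox W} := tmap hautV hautV.

Lemma tens_hautK : cancel tens_haut tens_hautV.
Proof.
by elim/tensor_ind => [x y|t u Et Eu]; [rewrite !tmapE !hautK|rewrite !linearD Et Eu].
Qed.

Lemma tens_hautVK : cancel tens_hautV tens_haut.
Proof.
by elim/tensor_ind => [x y|t u Et Eu]; [rewrite !tmapE !hautVK|rewrite !linearD Et Eu].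
Qed.

HB.instance Definition _ :=
  Lmodule_isHomSpace.Build k (V \Ox W) tens_hautK tens_hautVK.

Lemma haut_tens (x : V) (y : W) : haut (x \ox y) = haut x \ox haut y.
Proof. exact: tmapE. Qed.

Lemma hautV_tens (x : V) (y : W) : hautV (x \ox y) = hautV x \ox hautV y.
Proof. exact: tmapE. Qed.

End TensorHomSpace.

Definition hom_algebra (k : fieldType) (A : homSpaceType k)
    (mul : {linear A \Ox A -> A}) (one : A) : Prop :=
  [/\ forall a b c, mul (haut a \ox mul (b \ox c)) = mul (mul (a \ox b) \ox haut c),
      forall a, mul (a \ox one) = haut a,
      forall a, mul (one \ox a) = haut a,
      forall a b, haut (mul (a \ox b)) = mul (haut a \ox haut b)
    & haut one = one].

HB.mixin Record HomSpace_isHomAlgebra (k : fieldType) A of HomSpace k A := {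
  hmul : {linear A \Ox A -> A};
  hone : A;
  hmulP : hom_algebra hmul hone
}.

#[short(type="homAlgType")]
HB.structure Definition HomAlgebra (k : fieldType) :=
  {A of HomSpace k A & HomSpace_isHomAlgebra k A}.

Notation "a *h b" := (hmul (a \ox b)) : ring_scope.

Section HomAlgebraTheory.
Variables (k : fieldType) (A : homAlgType k).
Implicit Types a b c : A.

Lemma hmulA a b c : haut a *h (b *h c) = (a *h b) *h haut c.
Proof. by have [+ _ _ _ _] := @hmulP k A. Qed.

Lemma hmulr1 a : a *h hone = haut a.
Proof. by have [_ + _ _ _] := @hmulP k A. Qed.

Lemma hmul1r a : hone *h a = haut a.
Proof. by have [_ _ + _ _] := @hmulP k A. Qed.

Lemma hautM a b : haut (a *h b) = haut a *h haut b.
Proof. by have [_ _ _ + _] := @hmulP k A. Qed.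

Lemma haut1 : haut hone = hone :> A.
Proof. by have [_ _ _ _ +] := @hmulP k A. Qed.

Lemma hautVM a b : hautV (a *h b) = hautV a *h hautV b.
Proof. by apply: (can_inj (@hautK k A)); rewrite hautM !hautVK. Qed.

Lemma hautV1 : hautV hone = hone :> A.
Proof. by apply: (can_inj (@hautK k A)); rewrite hautVK haut1. Qed.

End HomAlgebraTheory.

Definition hom_algebra_map (k : fieldType) (A B : homAlgType k)
    (f : {linear A -> B}) : Prop :=
  [/\ forall a, f (haut a) = haut (f a),
      forall a b, f (a *h b) = f a *h f b
    & f hone = hone].

Section TensorHomAlgebra.
Variables (k : fieldType) (A B : homAlgType k).

Definition tens_mul_fun (t u : A \Ox B) : A \Ox B :=
  \sw_(a, b <- t) \sw_(a', b' <- u) ((a *h a') \ox (b *h b')).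

Lemma tens_mul_linearl u : linear (tens_mul_fun^~ u).
Proof. rewrite /tens_mul_fun; solve_linear. Qed.

Lemma tens_mul_linearr t : linear (tens_mul_fun t).
Proof. rewrite /tens_mul_fun; solve_linear. Qed.

Definition tens_mul : {linear (A \Ox B) \Ox (A \Ox B) -> A \Ox B} :=
  tlift tens_mul_linearl tens_mul_linearr.

Lemma tens_mulE a b a' b' :
  tens_mul ((a \ox b) \ox (a' \ox b')) = (a *h a') \ox (b *h b').
Proof.
rewrite tliftE /tens_mul_fun !sweedlerE //; solve_linear.
Qed.

Lemma tens_mulP : hom_algebra tens_mul (hone \ox hone).
Proof.
split.
- move=> t u v; move: t.
  apply: tensor_ext => [||a b]; [solve_linear..|].
  move: u; apply: tensor_ext => [||a' b']; [solve_linear..|].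
  move: v; apply: tensor_ext => [||a'' b'']; [solve_linear..|].
  by rewrite !(haut_tens, tens_mulE) !hmulA.
- apply: tensor_ext => [||a b]; [solve_linear..|].
  by rewrite haut_tens tens_mulE !hmulr1.
- apply: tensor_ext => [||a b]; [solve_linear..|].
  by rewrite haut_tens tens_mulE !hmul1r.
- move=> t u; move: t.
  apply: tensor_ext => [||a b]; [solve_linear..|].
  move: u; apply: tensor_ext => [||a' b']; [solve_linear..|].
  by rewrite !(haut_tens, tens_mulE) !hautM.
- by rewrite haut_tens !haut1.
Qed.

HB.instance Definition _ :=
  HomSpace_isHomAlgebra.Build k (A \Ox B) tens_mulP.

End TensorHomAlgebra.

(* The coassociativity axiom, and that of hom_comodule below, are stated in   *)
(* the bracketing C \Ox (C \Ox C).                                            *)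
HB.mixin Record HomSpace_isHomCoalgebra (k : fieldType) C of HomSpace k C := {
  hcomul : {linear C -> C \Ox C};
  hcounit : {scalar C};
  hcomulA : forall c : C,
    \sw_(c1, c2 <- hcomul c) hautV c1 \ox hcomul c2
    = \sw_(c1, c2 <- hcomul c) \sw_(c11, c12 <- hcomul c1)
        c11 \ox (c12 \ox hautV c2);
  hcounitr : forall c : C, \sw_(c1, c2 <- hcomul c) hcounit c2 *: c1 = hautV c;
  hcounitl : forall c : C, \sw_(c1, c2 <- hcomul c) hcounit c1 *: c2 = hautV c;
  hcomul_haut : forall c : C,
    hcomul (haut c) = \sw_(c1, c2 <- hcomul c) haut c1 \ox haut c2;
  hcounit_haut : forall c : C, hcounit (haut c) = hcounit c
}.

#[short(type="homCoalgType")]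
HB.structure Definition HomCoalgebra (k : fieldType) :=
  {C of HomSpace k C & HomSpace_isHomCoalgebra k C}.

(* The products in the axioms hcomulM and hcomul1 are those of H \Ox H. *)
HB.mixin Record HomAlgCoalg_isHomHopf (k : fieldType) H
    of HomAlgebra k H & HomCoalgebra k H := {
  hcomulM : forall g h : H, hcomul (g *h h) = hcomul g *h hcomul h;
  hcomul1 : hcomul (hone : H) = hone \ox hone;
  hcounitM : forall g h : H, hcounit (g *h h) = hcounit g * hcounit h;
  hcounit1 : hcounit (hone : H) = 1;
  antipode : {linear H -> H};
  antipode_haut : forall h : H, antipode (haut h) = haut (antipode h);
  antipodel : forall h : H,
    \sw_(h1, h2 <- hcomul h) antipode h1 *h h2 = hcounit h *: hone;
  antipoder : forall h : H,
    \sw_(h1, h2 <- hcomul h) h1 *h antipode h2 = hcounit h *: hone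
}.

#[short(type="homHopfType")]
HB.structure Definition HomHopf (k : fieldType) :=
  {H of HomAlgebra k H & HomCoalgebra k H & HomAlgCoalg_isHomHopf k H}.

Section HomModules.
Variables (k : fieldType) (A : homAlgType k).

Definition hom_module (M : homSpaceType k) (act : {linear A \Ox M -> M}) : Prop :=
  [/\ forall a b m,
        act (haut a \ox act (b \ox m)) = act ((a *h b) \ox haut m),
      forall m, act (hone \ox m) = haut m
    & forall a m, haut (act (a \ox m)) = act (haut a \ox haut m)].

Definition hom_module_map (M N : homSpaceType k)
    (actM : {linear A \Ox M -> M}) (actN : {linear A \Ox N -> N})
    (f : {linear M -> N}) : Prop :=
  (forall m, f (haut m) = haut (f m)) /\
  (forall a m, f (actM (a \ox m)) = actN (a \ox f m)).

End HomModules.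

Section HomComodules.
Variables (k : fieldType) (H : homHopfType k).

Definition hom_comodule (M : homSpaceType k) (rho : {linear M -> M \Ox H}) : Prop :=
  [/\ forall m,
        \sw_(m0, m1 <- rho m) hautV m0 \ox hcomul m1
        = \sw_(m0, m1 <- rho m) \sw_(m00, m01 <- rho m0)
            m00 \ox (m01 \ox hautV m1),
      forall m, \sw_(m0, m1 <- rho m) hcounit m1 *: m0 = hautV m
    & forall m, rho (haut m) = \sw_(m0, m1 <- rho m) haut m0 \ox haut m1].

Definition hom_comodule_map (M N : homSpaceType k)
    (rhoM : {linear M -> M \Ox H}) (rhoN : {linear N -> N \Ox H})
    (f : {linear M -> N}) : Prop :=
  (forall m, f (haut m) = haut (f m)) /\
  (forall m, rhoN (f m) = \sw_(m0, m1 <- rhoM m) f m0 \ox m1).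

End HomComodules.

HB.mixin Record HomAlgebra_isHomComodAlg (k : fieldType) (H : homHopfType k) B
    of HomAlgebra k B := {
  hcoact : {linear B -> B \Ox H};
  hcoact_comodule : hom_comodule hcoact;
  hcoact_algebra_map : hom_algebra_map hcoact
}.

#[short(type="homComodAlgType")]
HB.structure Definition HomComodAlg (k : fieldType) (H : homHopfType k) :=
  {B of HomAlgebra k B & HomAlgebra_isHomComodAlg k H B}.

Section Coinvariants.
Variables (k : fieldType) (H : homHopfType k) (B : homComodAlgType H).

Definition coinvariant : {pred B} :=
  fun b => `[< hcoact b = hautV b \ox (hone : H) >].

Lemma coinvariantP b :
  reflect (hcoact b = hautV b \ox (hone : H)) (b \in coinvariant).
Proof. exact: asboolP. Qed.

Lemma coinvariant_submod : submod_closed coinvariant.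
Proof.
split=> [|c x y /coinvariantP Ex /coinvariantP Ey].
  by apply/coinvariantP; rewrite !linear0; have := @linear_tensl k B B H id hone
    (@linear_id _ B) (-1) 0 0; rewrite !scaleN1r oppr0 addr0 addNr => ->.
apply/coinvariantP; rewrite !linearP Ex Ey.
by rewrite -(@linear_tensl k B B H id hone (@linear_id _ B)).
Qed.

Lemma coinvariant_haut b : b \in coinvariant -> haut b \in coinvariant.
Proof.
move=> /coinvariantP E; apply/coinvariantP.
have [+ _ _] := @hcoact_algebra_map k H B.
by move=> ->; rewrite E haut_tens haut1 hautVK hautK.
Qed.

Lemma coinvariant_hautV b : b \in coinvariant -> hautV b \in coinvariant.
Proof.
move=> /coinvariantP E; apply/coinvariantP.
apply: (can_inj (@hautK k (B \Ox H))).
have [<- _ _] := @hcoact_algebra_map k H B.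
by rewrite haut_tens !hautVK haut1.
Qed.

Lemma coinvariantM a b :
  a \in coinvariant -> b \in coinvariant -> a *h b \in coinvariant.
Proof.
move=> /coinvariantP Ea /coinvariantP Eb; apply/coinvariantP.
have [_ -> _] := @hcoact_algebra_map k H B.
by rewrite Ea Eb hautVM [LHS]tens_mulE hmul1r haut1.
Qed.

Lemma coinvariant1 : hone \in coinvariant.
Proof.
apply/coinvariantP; have [_ _ ->] := @hcoact_algebra_map k H B.
by rewrite hautV1.
Qed.

(* The Hom-algebra of coinvariants, with the restricted structure. *)
Record coinv : Type := Coinv { coinv_val : B; _ : coinv_val \in coinvariant }.

HB.instance Definition _ := [isSub for coinv_val].
HB.instance Definition _ := [Choice of coinv by <:].
HB.instance Definition _ := GRing.SubChoice_isSubLmodule.Build k B coinvariant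
  coinv (GRing.submod_closed_semi coinvariant_submod).

Definition coinv_haut_fun (a : coinv) : coinv :=
  Coinv (coinvariant_haut (valP a)).
Definition coinv_hautV_fun (a : coinv) : coinv :=
  Coinv (coinvariant_hautV (valP a)).

Lemma coinv_haut_linear : linear coinv_haut_fun.
Proof. by move=> c x y; apply: val_inj; rewrite /= !linearP. Qed.

Lemma coinv_hautV_linear : linear coinv_hautV_fun.
Proof. by move=> c x y; apply: val_inj; rewrite /= !linearP. Qed.

HB.instance Definition _ :=
  GRing.isLinear.Build k coinv coinv *:%R coinv_haut_fun coinv_haut_linear.
HB.instance Definition _ :=
  GRing.isLinear.Build k coinv coinv *:%R coinv_hautV_fun coinv_hautV_linear.

Definition coinv_haut : {linear coinv -> coinv} := coinv_haut_fun.
Definition coinv_hautV : {linear coinv -> coinv} := coinv_hautV_fun.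

Lemma coinv_hautK : cancel coinv_haut coinv_hautV.
Proof. by move=> a; apply: val_inj; rewrite /= hautK. Qed.

Lemma coinv_hautVK : cancel coinv_hautV coinv_haut.
Proof. by move=> a; apply: val_inj; rewrite /= hautVK. Qed.

HB.instance Definition _ := Lmodule_isHomSpace.Build k coinv
  coinv_hautK coinv_hautVK.

Definition coinv_mul_fun (a b : coinv) : coinv :=
  Coinv (coinvariantM (valP a) (valP b)).

Lemma coinv_mul_linearl b : linear (coinv_mul_fun^~ b).
Proof.
have L : linear (fun a : coinv => val a *h val b) by solve_linear.
by move=> c x y; apply: val_inj; rewrite [LHS]L [RHS]linearP.
Qed.

Lemma coinv_mul_linearr a : linear (coinv_mul_fun a).
Proof.
have L : linear (fun b : coinv => val a *h val b) by solve_linear.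
by move=> c x y; apply: val_inj; rewrite [LHS]L [RHS]linearP.
Qed.

Definition coinv_mul : {linear coinv \Ox coinv -> coinv} :=
  tlift coinv_mul_linearl coinv_mul_linearr.

Lemma val_coinv_mul (a b : coinv) : val (coinv_mul (a \ox b)) = val a *h val b.
Proof. by rewrite tliftE. Qed.

Lemma coinv_mulP : hom_algebra coinv_mul (Coinv coinvariant1).
Proof.
split=> *; apply: val_inj; rewrite /= ?val_coinv_mul /= ?val_coinv_mul.
- exact: hmulA.
- exact: hmulr1.
- exact: hmul1r.
- exact: hautM.
- exact: haut1.
Qed.

HB.instance Definition _ := HomSpace_isHomAlgebra.Build k coinv coinv_mulP.

Lemma coinv_act_linearl (b : B) : linear (fun a : coinv => val a *h b).
Proof. solve_linear. Qed.

Lemma coinv_act_linearr (a : coinv) : linear (fun b : B => val a *h b).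
Proof. solve_linear. Qed.

Definition coinv_act : {linear coinv \Ox B -> B} :=
  tlift coinv_act_linearl coinv_act_linearr.

Lemma coinv_actE (a : coinv) b : coinv_act (a \ox b) = val a *h b.
Proof. exact: tliftE. Qed.

Lemma coinv_act_module : hom_module coinv_act.
Proof.
split=> *; rewrite !coinv_actE ?val_coinv_mul.
- exact: hmulA.
- exact: hmul1r.
- exact: hautM.
Qed.

End Coinvariants.

Section Convolution.
Variables (k : fieldType) (C : homCoalgType k) (A : homAlgType k).

Definition conv_inverse (f g : {linear C -> A}) : Prop :=
  (forall c, \sw_(c1, c2 <- hcomul c) f c1 *h g c2 = hcounit c *: hone) /\
  (forall c, \sw_(c1, c2 <- hcomul c) g c1 *h f c2 = hcounit c *: hone).

Definition conv_inverse2 (f g : {linear C \Ox C -> A}) : Prop :=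
  (forall c d,
     \sw_(c1, c2 <- hcomul c) \sw_(d1, d2 <- hcomul d)
       f (c1 \ox d1) *h g (c2 \ox d2) = (hcounit c * hcounit d) *: hone) /\
  (forall c d,
     \sw_(c1, c2 <- hcomul c) \sw_(d1, d2 <- hcomul d)
       g (c1 \ox d1) *h f (c2 \ox d2) = (hcounit c * hcounit d) *: hone).

End Convolution.

(* The extension coinv B of B is H-cleft. *)
Definition cleft (k : fieldType) (H : homHopfType k) (B : homComodAlgType H) :
    Prop :=
  exists gamma : {linear H -> B},
    hom_comodule_map (hcomul : {linear H -> H \Ox H}) hcoact gamma /\
    exists gammaV : {linear H -> B}, conv_inverse gamma gammaV.

Section CrossedProduct.
Variables (k : fieldType) (A : homAlgType k) (H : homHopfType k).

Definition weak_action (act : {linear H \Ox A -> A}) : Prop :=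
  [/\ forall h a, haut (act (h \ox a)) = act (haut h \ox haut a),
      forall h, act (h \ox hone) = hcounit h *: hone
    & forall h a b, act (h \ox (a *h b))
        = \sw_(h1, h2 <- hcomul h) act (h1 \ox a) *h act (h2 \ox b)].

Section Product.
Variables (act : {linear H \Ox A -> A}) (sigma : {linear H \Ox H -> A}).

Definition crossed_mul_fun (t u : A \Ox H) : A \Ox H :=
  \sw_(a, h <- t) \sw_(b, l <- u)
  \sw_(h1, h2 <- hcomul h) \sw_(h21, h22 <- hcomul h2) \sw_(l1, l2 <- hcomul l)
    ((a *h (act (hautV h1 \ox hautV (hautV b)) *h sigma (h21 \ox hautV l1)))
     \ox (haut (haut h22) *h haut l2)).

Lemma crossed_mul_linearl u : linear (crossed_mul_fun^~ u).
Proof. rewrite /crossed_mul_fun; solve_linear. Qed.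

Lemma crossed_mul_linearr t : linear (crossed_mul_fun t).
Proof. rewrite /crossed_mul_fun; solve_linear. Qed.

Definition crossed_mul : {linear (A \Ox H) \Ox (A \Ox H) -> A \Ox H} :=
  tlift crossed_mul_linearl crossed_mul_linearr.

Lemma crossed_mulE a h b l :
  crossed_mul ((a \ox h) \ox (b \ox l))
  = \sw_(h1, h2 <- hcomul h) \sw_(h21, h22 <- hcomul h2)
    \sw_(l1, l2 <- hcomul l)
      ((a *h (act (hautV h1 \ox hautV (hautV b)) *h sigma (h21 \ox hautV l1)))
       \ox (haut (haut h22) *h haut l2)).
Proof.
by rewrite tliftE /crossed_mul_fun; rewrite 2?sweedlerE //; solve_linear.
Qed.

End Product.

Record crossedProduct := CrossedProduct {
  cp_act : {linear H \Ox A -> A};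
  cp_actP : weak_action cp_act;
  cp_cocycle : {linear H \Ox H -> A};
  cp_cocycleP : exists cocycleV, conv_inverse2 cp_cocycle cocycleV;
  cp_algebra : hom_algebra (crossed_mul cp_act cp_cocycle) (hone \ox hone)
}.

(* The vector space underlying a crossed product, with its twisted product    *)
(* instead of the product of A \Ox H.                                         *)
Definition cprod (X : crossedProduct) : Type := A \Ox H.

Section CprodStructure.
Variable X : crossedProduct.

HB.instance Definition _ := HomSpace.copy (cprod X) (A \Ox H).
HB.instance Definition _ :=
  HomSpace_isHomAlgebra.Build k (cprod X) (cp_algebra X).

Lemma cprod_mulE (t u : cprod X) :
  t *h u = crossed_mul (cp_act X) (cp_cocycle X) (t \ox u).
Proof. by []. Qed.

Definition cprod_act_fun (a : A) (t : A \Ox H) : A \Ox H :=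
  \sw_(b, h <- t) (hautV a *h b) \ox haut h.

Lemma cprod_act_linearl t : linear (cprod_act_fun^~ t).
Proof. rewrite /cprod_act_fun; solve_linear. Qed.

Lemma cprod_act_linearr a : linear (cprod_act_fun a).
Proof. rewrite /cprod_act_fun; solve_linear. Qed.

Definition cprod_act : {linear A \Ox cprod X -> cprod X} :=
  tlift cprod_act_linearl cprod_act_linearr.

Lemma cprod_actE a b h :
  cprod_act (a \ox (b \ox h : A \Ox H)) = (hautV a *h b) \ox haut h.
Proof. by rewrite tliftE [LHS]sweedlerE //; solve_linear. Qed.

Lemma cprod_act_module : hom_module cprod_act.
Proof.
split.
- move=> a b; apply: tensor_ext => [||c h]; [solve_linear..|].
  by rewrite haut_tens !cprod_actE hautK hautVM -[in LHS](hautVK a) hmulA.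
- apply: tensor_ext => [||c h]; [solve_linear..|].
  by rewrite haut_tens cprod_actE hautV1 hmul1r.
- move=> a; apply: tensor_ext => [||c h]; [solve_linear..|].
  by rewrite haut_tens !cprod_actE haut_tens hautM hautVK hautK.
Qed.

Lemma cprod_coact_linearl (h : H) :
  linear (fun a : A => \sw_(h1, h2 <- hcomul h) (hautV a \ox h1) \ox haut h2).
Proof. solve_linear. Qed.

Lemma cprod_coact_linearr (a : A) :
  linear (fun h : H => \sw_(h1, h2 <- hcomul h) (hautV a \ox h1) \ox haut h2).
Proof. solve_linear. Qed.

Definition cprod_coact : {linear cprod X -> cprod X \Ox H} :=
  tlift cprod_coact_linearl cprod_coact_linearr.

Lemma cprod_coactE a h :
  cprod_coact (a \ox h)
  = \sw_(h1, h2 <- hcomul h) (hautV a \ox h1) \ox haut h2.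
Proof. exact: tliftE. Qed.

End CprodStructure.
End CrossedProduct.

Arguments coinv_act {k H} B.
Arguments cprod_act {k A H} X.
Arguments cprod_coact {k A H} X.

(* Main.v *)
Require Import Defs.
From HB Require Import structures.
From mathcomp Require Import all_boot all_algebra.
From mathcomp Require Import boolp.

(** Untwisting. The structure automorphisms can be absorbed: for a Hom-algebra
    the product [a *o b := hautV (a *h b)] is associative and unital in the
    ordinary sense, and for a Hom-coalgebra [udelta c := hcomul (haut c)] is an
    ordinary coassociative comultiplication with the same counit. Linear maps
    from a coalgebra to an algebra then form an ordinary monoid under the
    convolution [f *c g], convolution inverses are the same as in the twisted
    sense, and the theorem becomes the classical one on cleft extensions of an
    ordinary Hopf algebra [H]. Most computations below take place in such
    convolution monoids instead of Sweedler sums. In particular, with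
    [tl b := b \ox 1] and [tr h := 1 \ox h] in the algebra [B \Ox H], a linear
    map [gamma : H -> B] is colinear exactly when the coaction satisfies
    [rho o gamma = (tl o gamma) * tr] ([comodule_mapP]).

    From cleft to crossed. Let [gamma] be colinear with inverse [gammaV].
    Inverses in a monoid reverse products, so
    [rho o gammaV = (tr o S) * (tl o gammaV)] ([urho_cinv]). Hence in any word
    such as [gamma * a * gammaV] the factors [tr] and [tr o S] meet and cancel
    under [rho], and the word takes coinvariant values. This applies to the weak
    action [h |> b = (gamma * b * gammaV) h], to the cocycle
    [p1 * p2 * q^-1] on [H \Ox H], where [p1], [p2], [q] are [gamma] composed
    with the two projections and with the product, and to the map
    [P = id * gammaV] on [B]. As [(h |> b) p1 = p1 b], the twisted product is
    what makes [a # h |-> a gamma(h)] multiplicative ([cleft_sigma_twist],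
    [cleft_isoM]); its inverse is [b |-> P(b_0) # b_1]. The Hom-algebra axioms
    of the crossed product are pulled back from [B] along this injection.

    From crossed to cleft. Put [gamma(h) = 1 # h], up to untwisting. Then [p1 * p2 = sigma * q],
    and [gamma] must be shown to be convolution invertible. A linear map
    [s : C -> A] is convolution invertible if and only if the map [shift s],
    which sends [a \ox c] to [a s(c_1) \ox c_2], is bijective
    ([cinv_shift_bij], [shift_bij_cinv]). Identify [B] with [A \Ox H]; the
    formula for [p1 * p2] says that [shift gamma] on [A \Ox H \Ox H] is
    [shift sigma] followed by [id \Ox shift id_H]. The first is bijective since
    [sigma] is invertible, the second since the antipode inverts [id_H]. *)

Set Implicit Arguments.
Unset Strict Implicit.
Unset Printing Implicit Defensive.

Import GRing.Theory.
Local Open Scope ring_scope.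

Reserved Notation "a *o b" (at level 40, left associativity).
Reserved Notation "f *c g" (at level 40, left associativity).
Reserved Notation "g \oL f" (at level 50, left associativity).

(** * Linear maps and Sweedler sums *)

Section LinearMaps.
Variable k : fieldType.
Implicit Types (L M N P : lmodType k).

(** Bundled linear maps that agree pointwise are equal, which allows identities
    between convolution products to be used as rewrite rules. *)
Lemma linear_ext M N (f g : {linear M -> N}) : f =1 g -> f = g.
Proof.
case: f g => [f cf] [g cg] /= /funext /= E; move: cf cg; rewrite {}E => cf cg.
congr GRing.Linear.Pack.
case: cf cg => [[a1] [a2]] [[b1] [b2]].
by rewrite (Prop_irrelevance a1 b1) (Prop_irrelevance a2 b2).
Qed.

Definition mklin M N (f : M -> N) (lf : linear f) : {linear M -> N} :=
  HB.pack f (GRing.isLinear.Build k M N *:%R f lf).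

Definition lcomp M N P (g : {linear N -> P}) (f : {linear M -> N}) :
  {linear M -> P} := g \o f.

Definition lid M : {linear M -> M} := idfun.

Lemma linear_scaler L M c (f : L -> M) : linear f -> linear (fun z => c *: f z).
Proof. by move=> lf a x y; rewrite lf scalerDr !scalerA mulrC. Qed.

Lemma linear_scalel_comp L M N (g : {scalar M}) (f : L -> M) (n : N) :
  linear f -> linear (fun z => g (f z) *: n).
Proof. by move=> lf c x y; rewrite lf linearP scalerDl scalerA. Qed.

End LinearMaps.

Notation "g \oL f" := (lcomp g f) : ring_scope.

(** Proves that a Sweedler expression is linear in one of its variables. The
    last alternative uses linearity hypotheses on maps that are not bundled. *)
Ltac lin :=
  intros; cbv beta;
  first
  [ assumption
  | exact: linear_id
  | exact: linearP
  | apply: linear_sw; lin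
  | apply: linear_sw_body; lin
  | apply: linear_tensl; lin
  | apply: linear_tensr; lin
  | apply: linear_scalel_comp; lin
  | apply: linear_scaler; lin
  | apply: linear_app; lin
  | match goal with E : _ |- _ => solve [apply: E] end ].

Section SweedlerSums.
Variable k : fieldType.
Implicit Types (L M N P Q : lmodType k).

Lemma eq_sw M N P (f g : M -> N -> P) t :
  (forall x y, f x y = g x y) -> sweedler f t = sweedler g t.
Proof. by move=> E; apply: eq_bigr => p _; apply: E. Qed.

Lemma linear_sweedler M N P Q (g : {linear P -> Q}) (f : M -> N -> P) t :
  g (\sw_(x, y <- t) f x y) = \sw_(x, y <- t) g (f x y).
Proof. exact: raddf_sum. Qed.

Lemma exchange_sw M N M' N' P (f : M -> N -> M' -> N' -> P) t u :
  \sw_(x, y <- t) \sw_(z, w <- u) f x y z w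
  = \sw_(z, w <- u) \sw_(x, y <- t) f x y z w.
Proof. exact: exchange_big. Qed.

Lemma sweedler_sw M N M' N' P (f : M' -> N' -> P) (g : M -> N -> M' \Ox N') t :
  (forall y, linear (f^~ y)) -> (forall x, linear (f x)) ->
  \sw_(x, y <- \sw_(z, w <- t) g z w) f x y
  = \sw_(z, w <- t) \sw_(x, y <- g z w) f x y.
Proof. by move=> fl fr; have := linear_sweedler (tlift fl fr) g t. Qed.

Lemma sweedler_id M N (t : M \Ox N) : \sw_(x, y <- t) x \ox y = t.
Proof. by rewrite [RHS]tensor_sum. Qed.

Lemma tens_scalel M N c (x : M) (y : N) : (c *: x) \ox y = c *: (x \ox y).
Proof. by rewrite -[LHS]/(mklin (linear_tensl y (@linear_id k M)) _) linearZ. Qed.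

Lemma tens_scaler M N c (x : M) (y : N) : x \ox (c *: y) = c *: (x \ox y).
Proof. by rewrite -[LHS]/(mklin (linear_tensr x (@linear_id k N)) _) linearZ. Qed.

Lemma scale_sw M N P c (f : M -> N -> P) t :
  c *: (\sw_(x, y <- t) f x y) = \sw_(x, y <- t) c *: f x y.
Proof. exact: scaler_sumr. Qed.

Lemma tens_swl M N M' N' (f : M -> N -> M') t (z : N') :
  (\sw_(x, y <- t) f x y) \ox z = \sw_(x, y <- t) f x y \ox z.
Proof. exact: (linear_sweedler (mklin (linear_tensl z (@linear_id k M')))). Qed.

Lemma tens_swr M N M' N' (f : M -> N -> N') t (z : M') :
  z \ox (\sw_(x, y <- t) f x y) = \sw_(x, y <- t) z \ox f x y.
Proof. exact: (linear_sweedler (mklin (linear_tensr z (@linear_id k N')))). Qed.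

Lemma tlift3E M N N' P (f : M -> N -> N' -> P) :
  (forall y z, linear (fun x => f x y z)) ->
  (forall x z, linear (fun y => f x y z)) ->
  (forall x y, linear (f x y)) ->
  exists g : {linear M \Ox (N \Ox N') -> P},
    forall x y z, g (x \ox (y \ox z)) = f x y z.
Proof.
move=> f1 f2 f3.
have l1 (t : N \Ox N') : linear (fun x => \sw_(y, z <- t) f x y z) by lin.
have l2 x : linear (fun t : N \Ox N' => \sw_(y, z <- t) f x y z) by lin.
by exists (tlift l1 l2) => x y z; rewrite tliftE sweedlerE.
Qed.

(** A coassociativity law is an identity in [M \Ox (N \Ox N)]; composing it
    with the linear map that a trilinear [f] induces there lets it act on any
    expression. The maps [u] and [v] absorb the structure automorphisms that a
    Hom-coassociativity law carries. *)
Lemma trilinear_coassoc M N P (t : M \Ox N) (d : M -> M \Ox N)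
    (e : N -> N \Ox N) (u : M -> M) (v : N -> N) (f : M -> N -> N -> P) :
  \sw_(x, y <- t) u x \ox e y
  = \sw_(x, y <- t) \sw_(z, w <- d x) z \ox (w \ox v y) ->
  (forall y z, linear (fun x => f x y z)) ->
  (forall x z, linear (fun y => f x y z)) ->
  (forall x y, linear (f x y)) ->
  \sw_(x, y <- t) \sw_(z, w <- e y) f (u x) z w
  = \sw_(x, y <- t) \sw_(z, w <- d x) f z w (v y).
Proof.
move=> tA f1 f2 f3; have [g gE] := tlift3E f1 f2 f3.
have := congr1 g tA; rewrite !linear_sweedler => E.
rewrite (eq_sw (g := fun x y => g (u x \ox e y))) ?E.
  by apply: eq_sw => x y; rewrite linear_sweedler; apply: eq_sw => z w.
move=> x y; rewrite -[in RHS](sweedler_id (e y)) tens_swr linear_sweedler.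
by apply: eq_sw => z w.
Qed.

(** Tensoring a linear bijection with [N], up to the associativity of the
    tensor product. *)
Lemma bij_assoc_tens L M N P (f : {linear L \Ox M -> P}) : bijective f ->
  exists2 J : {linear L \Ox (M \Ox N) -> P \Ox N},
    forall x y z, J (x \ox (y \ox z)) = f (x \ox y) \ox z & bijective J.
Proof.
move=> [fV fK fVK].
have [J JE] : exists J : {linear L \Ox (M \Ox N) -> P \Ox N},
    forall x y z, J (x \ox (y \ox z)) = f (x \ox y) \ox z.
  by apply: (tlift3E (f := fun x y z => f (x \ox y) \ox z)); lin.
pose fV' : {linear P -> L \Ox M} := mklin (can2_linear fK fVK).
have l1 (z : N) : linear (fun p => \sw_(x, y <- fV' p) x \ox (y \ox z)) by lin.
have l2 (p : P) : linear (fun z : N => \sw_(x, y <- fV' p) x \ox (y \ox z)).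
  by lin.
exists J => //; exists (tlift l1 l2).
  apply: tensor_ext => [||x]; [lin..|].
  apply: tensor_ext => [||y z]; [lin..|].
  by rewrite JE tliftE /fV' /= fK sweedlerE //; lin.
apply: tensor_ext => [||p z]; [lin..|].
have fp : f (fV' p) = p by apply: fVK.
rewrite tliftE linear_sweedler -[in RHS]fp -[X in f X]sweedler_id.
rewrite linear_sweedler tens_swl.
by apply: eq_sw => x y; rewrite JE.
Qed.

End SweedlerSums.

(** * Untwisting Hom-algebras and Hom-coalgebras *)

Section UntwistedAlgebra.
Variables (k : fieldType) (A : homAlgType k).

(** The lock keeps [a *o b] from being simplified back to [hautV (a *h b)],
    whose laws are the twisted ones; [udelta], [conv_along] and [urho] are
    locked for the same reason. *)
Definition umul : {linear A \Ox A -> A} := locked (hautV \oL hmul).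

End UntwistedAlgebra.

Notation "a *o b" := (umul _ (a \ox b)) : ring_scope.

Section UntwistedAlgebraTheory.
Variables (k : fieldType) (A : homAlgType k).
Implicit Types a b c : A.

Lemma umulE a b : a *o b = hautV (a *h b).
Proof. by rewrite /umul; unlock. Qed.

Lemma hmulE a b : a *h b = haut (a *o b).
Proof. by rewrite umulE hautVK. Qed.

Lemma haut_umul a b : haut (a *o b) = haut a *o haut b.
Proof. by rewrite !umulE hautVK hautVM !hautK. Qed.

Lemma hautV_umul a b : hautV (a *o b) = hautV a *o hautV b.
Proof. by rewrite !umulE hautVM. Qed.

Lemma umulA a b c : a *o (b *o c) = (a *o b) *o c.
Proof.
apply: (can_inj (@hautK k A)); apply: (can_inj (@hautK k A)).
have := hmulA a b c; rewrite !hmulE !haut_umul => E.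
exact: E.
Qed.

Lemma umulr1 a : a *o hone = a.
Proof. by rewrite umulE hmulr1 hautK. Qed.

Lemma umul1r a : hone *o a = a.
Proof. by rewrite umulE hmul1r hautK. Qed.

Lemma umulZl (c : k) a b : (c *: a) *o b = c *: (a *o b).
Proof. by rewrite tens_scalel linearZ. Qed.

Lemma umulZr (c : k) a b : a *o (c *: b) = c *: (a *o b).
Proof. by rewrite tens_scaler linearZ. Qed.

End UntwistedAlgebraTheory.

Lemma umul_tens (k : fieldType) (A B : homAlgType k) (a a' : A) (b b' : B) :
  (a \ox b) *o (a' \ox b') = (a *o a') \ox (b *o b').
Proof. by rewrite !umulE -hautV_tens -[in RHS]tens_mulE. Qed.

Section UntwistedAlgebraMaps.
Variable k : fieldType.
Implicit Types A B : homAlgType k.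

Definition ualg_map A B (phi : {linear A -> B}) : Prop :=
  (forall a b, phi (a *o b) = phi a *o phi b) /\ phi hone = hone.

Lemma ualg_haut A : ualg_map (haut : {linear A -> A}).
Proof. by split; [apply: haut_umul | apply: haut1]. Qed.

Lemma ualg_hautV A : ualg_map (hautV : {linear A -> A}).
Proof. by split; [apply: hautV_umul | apply: hautV1]. Qed.

Lemma ualg_comp A B (C : homAlgType k)
    (phi : {linear A -> B}) (psi : {linear B -> C}) :
  ualg_map phi -> ualg_map psi -> ualg_map (psi \oL phi).
Proof. by move=> [M1 O1] [M2 O2]; split=> [a b|]; rewrite /= ?M1 ?M2 ?O1. Qed.

Lemma hom_algebra_map_ualg A B (phi : {linear A -> B}) :
  hom_algebra_map phi <-> (forall a, phi (haut a) = haut (phi a)) /\ ualg_map phi.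
Proof.
split=> [[E M O] | [E [M O]]].
  split=> //; split=> // a b; apply: (can_inj (@hautK k B)).
  by rewrite -E -!hmulE M.
by split=> // a b; rewrite !hmulE E M.
Qed.

Definition tensl (A : lmodType k) B : {linear A -> A \Ox B} :=
  mklin (linear_tensl (hone : B) (@linear_id k A)).

Definition tensr A (B : lmodType k) : {linear B -> A \Ox B} :=
  mklin (linear_tensr (hone : A) (@linear_id k B)).

Lemma ualg_tensl A B : ualg_map (tensl A B : {linear A -> A \Ox B}).
Proof. by split=> // a b; rewrite /= umul_tens umulr1. Qed.

Lemma ualg_tensr A B : ualg_map (tensr A B : {linear B -> A \Ox B}).
Proof. by split=> // a b; rewrite /= umul_tens umulr1. Qed.

Lemma tenslr_comm A B (a : A) (b : B) :
  tensl A B a *o tensr A B b = tensr A B b *o tensl A B a.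
Proof. by rewrite /= !umul_tens !umulr1 !umul1r. Qed.

(** Each pure tensor is a product, so a coaction with values in [A \Ox B] can be
    written as a convolution of a map into [A] with a map into [B]. *)
Lemma tenslrE A B (a : A) (b : B) : tensl A B a *o tensr A B b = a \ox b.
Proof. by rewrite /= !umul_tens !umulr1 !umul1r. Qed.

End UntwistedAlgebraMaps.

Section UntwistedCoalgebra.
Variables (k : fieldType) (C : homCoalgType k).

Definition udelta : {linear C -> C \Ox C} := locked (hcomul \oL haut).

Lemma udeltaE c : udelta c = hcomul (haut c).
Proof. by rewrite /udelta; unlock. Qed.

Lemma hcomul_sw (c : C) (P : lmodType k) (f : C -> C -> P) :
  (forall y, linear (f^~ y)) -> (forall x, linear (f x)) ->
  \sw_(x, y <- hcomul (haut c)) f x y = \sw_(x, y <- hcomul c) f (haut x) (haut y).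
Proof.
move=> fl fr; rewrite hcomul_haut sweedler_sw //.
by apply: eq_sw => x y; rewrite sweedlerE.
Qed.

Lemma udelta_sw (c : C) (P : lmodType k) (f : C -> C -> P) :
  (forall y, linear (f^~ y)) -> (forall x, linear (f x)) ->
  \sw_(x, y <- udelta c) f x y = \sw_(x, y <- hcomul c) f (haut x) (haut y).
Proof. by move=> fl fr; rewrite udeltaE; apply: hcomul_sw. Qed.

Lemma udelta_haut (c : C) (P : lmodType k) (f : C -> C -> P) :
  (forall y, linear (f^~ y)) -> (forall x, linear (f x)) ->
  \sw_(x, y <- udelta (haut c)) f x y = \sw_(x, y <- udelta c) f (haut x) (haut y).
Proof. by move=> fl fr; rewrite udeltaE hcomul_sw // udeltaE. Qed.

(** The Hom-coassociativity law at [haut (haut c)]: the two factors [haut] are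
    shared between the two comultiplications and the [hautV] of the law. *)
Lemma udeltaA (c : C) :
  \sw_(x, y <- udelta c) x \ox udelta y
  = \sw_(x, y <- udelta c) \sw_(z, w <- udelta x) z \ox (w \ox y).
Proof.
have := hcomulA (haut (haut c)); rewrite -!udeltaE.
rewrite (udelta_haut _ (f := fun x y => hautV x \ox hcomul y)); [|lin..].
rewrite (udelta_haut _ (f := fun x y => \sw_(z, w <- hcomul x) z \ox (w \ox hautV y)));
  [|lin..].
under eq_sw => x y do rewrite hautK -udeltaE.
move=> ->; apply: eq_sw => x y; rewrite -udeltaE.
by apply: eq_sw => z w; rewrite hautK.
Qed.

Lemma udelta_counitr (c : C) : \sw_(x, y <- udelta c) hcounit y *: x = c.
Proof. by rewrite udeltaE hcounitr hautK. Qed.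

Lemma udelta_counitl (c : C) : \sw_(x, y <- udelta c) hcounit x *: y = c.
Proof. by rewrite udeltaE hcounitl hautK. Qed.

Lemma counitr_sw (c : C) (P : lmodType k) (f : C -> P) : linear f ->
  \sw_(x, y <- udelta c) hcounit y *: f x = f c.
Proof.
move=> lf; rewrite -[in RHS](udelta_counitr c) -[RHS]/(mklin lf _) linear_sweedler.
by apply: eq_sw => x y; rewrite linearZ.
Qed.

Lemma counitl_sw (c : C) (P : lmodType k) (f : C -> P) : linear f ->
  \sw_(x, y <- udelta c) hcounit x *: f y = f c.
Proof.
move=> lf; rewrite -[in RHS](udelta_counitl c) -[RHS]/(mklin lf _) linear_sweedler.
by apply: eq_sw => x y; rewrite linearZ.
Qed.

Definition ucomodule (M : lmodType k) (d : {linear M -> M \Ox C}) : Prop :=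
  (forall m, \sw_(x, y <- d m) x \ox udelta y
     = \sw_(x, y <- d m) \sw_(z, w <- d x) z \ox (w \ox y)) /\
  (forall m, \sw_(x, y <- d m) hcounit y *: x = m).

Lemma ucomodule_udelta : ucomodule udelta.
Proof. by split; [apply: udeltaA | apply: udelta_counitr]. Qed.

Lemma coassoc_sw (M : lmodType k) (d : {linear M -> M \Ox C}) (m : M)
    (P : lmodType k) (f : M -> C -> C -> P) :
  ucomodule d ->
  (forall y z, linear (fun x => f x y z)) ->
  (forall x z, linear (fun y => f x y z)) ->
  (forall x y, linear (f x y)) ->
  \sw_(x, y <- d m) \sw_(z, w <- udelta y) f x z w
  = \sw_(x, y <- d m) \sw_(z, w <- d x) f z w y.
Proof.
by move=> [dA _]; apply: (trilinear_coassoc (u := id) (v := id)).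
Qed.

End UntwistedCoalgebra.
Arguments udelta {k C}.

(** * Convolution *)

Section Convolution.
Variables (k : fieldType) (C : homCoalgType k) (A : homAlgType k).

(** Convolution is defined along any coaction [d] of [C] on [M]: for
    [d = udelta] it is the product of the convolution monoid, and in general it
    makes linear maps out of [M] a right module over that monoid. *)
Section Along.
Variables (M : lmodType k) (d : {linear M -> M \Ox C}).

Definition conv_along_fun (f : {linear M -> A}) (g : {linear C -> A}) (m : M) :=
  \sw_(x, y <- d m) f x *o g y.

Lemma conv_along_linear f g : linear (conv_along_fun f g).
Proof. rewrite /conv_along_fun; lin. Qed.

Definition conv_along f g : {linear M -> A} :=
  locked (mklin (conv_along_linear f g)).

Lemma conv_alongE f g m : conv_along f g m = \sw_(x, y <- d m) f x *o g y.
Proof. by rewrite /conv_along; unlock. Qed.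

End Along.

Definition conv := conv_along (@udelta k C).

(** The scalar [a] seen in the convolution algebra; [cst hone] is its unit. *)
Definition cst (a : A) : {linear C -> A} := mklin (linear_scalel hcounit a).

End Convolution.

Notation "f *c g" := (conv f g) : ring_scope.

Section ConvolutionTheory.
Variables (k : fieldType) (C : homCoalgType k) (A : homAlgType k).
Implicit Types (f g h : {linear C -> A}) (a b : A).

Lemma convE f g c : (f *c g) c = \sw_(x, y <- udelta c) f x *o g y.
Proof. exact: conv_alongE. Qed.

Lemma conv_along_conv (M : lmodType k) (d : {linear M -> M \Ox C})
    (f : {linear M -> A}) g h :
  ucomodule d ->
  conv_along d f (g *c h) = conv_along d (conv_along d f g) h.
Proof.
move=> dP; apply: linear_ext => m; rewrite !conv_alongE.
under eq_sw => x y do rewrite convE tens_swr linear_sweedler.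
rewrite (coassoc_sw m (f := fun x z w => f x *o (g z *o h w))) //; [|lin..].
apply: eq_sw => x y; rewrite conv_alongE tens_swl linear_sweedler.
by apply: eq_sw => z w; rewrite umulA.
Qed.

Lemma conv_along_cst (M : lmodType k) (d : {linear M -> M \Ox C})
    (f : {linear M -> A}) a m :
  ucomodule d -> conv_along d f (cst C a) m = f m *o a.
Proof.
move=> [_ dP]; rewrite conv_alongE.
transitivity (f (\sw_(x, y <- d m) hcounit y *: x) *o a); last by rewrite dP.
rewrite linear_sweedler tens_swl linear_sweedler; apply: eq_sw => x y.
by rewrite /= umulZr linearZ umulZl.
Qed.

Lemma convA f g h : f *c (g *c h) = f *c g *c h.
Proof. exact: conv_along_conv (ucomodule_udelta C). Qed.

Lemma conv_cstr f a c : (f *c cst C a) c = f c *o a.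
Proof. exact: conv_along_cst (ucomodule_udelta C). Qed.

Lemma conv_cstl f a c : (cst C a *c f) c = a *o f c.
Proof.
rewrite convE -(counitl_sw c (f := fun x => a *o f x)); last by lin.
by apply: eq_sw => x y; rewrite umulZl.
Qed.

Lemma conv1f f : cst C hone *c f = f.
Proof. by apply: linear_ext => c; rewrite conv_cstl umul1r. Qed.

Lemma convf1 f : f *c cst C hone = f.
Proof. by apply: linear_ext => c; rewrite conv_cstr umulr1. Qed.

Lemma conv_cst a b : cst C a *c cst C b = cst C (a *o b).
Proof. by apply: linear_ext => c; rewrite conv_cstl /= umulZr. Qed.

Lemma conv_inv_uniq f g h :
  g *c f = cst C hone -> f *c h = cst C hone -> g = h.
Proof. by move=> gf fh; rewrite -[g]convf1 -fh convA gf conv1f. Qed.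

Definition cinv f g : Prop := f *c g = cst C hone /\ g *c f = cst C hone.

(** Evaluated at [haut c], the untwisted convolution product is [hautV] of the
    Hom-convolution at [c], and the counit and the identity are fixed by the
    automorphisms: the two notions of inverse agree. *)
Lemma conv_inverseP f g : conv_inverse f g <-> cinv f g.
Proof.
have E f' g' :
    (forall c, \sw_(x, y <- hcomul c) f' x *h g' y = hcounit c *: hone)
    <-> f' *c g' = cst C hone.
  split=> [E | E c].
    apply: linear_ext => c; rewrite convE.
    transitivity (hautV (\sw_(x, y <- hcomul (haut c)) f' x *h g' y)).
      rewrite linear_sweedler udeltaE.
      by apply: eq_sw => x y; rewrite umulE.
    by rewrite E linearZ /= hautV1 hcounit_haut.
  transitivity (haut ((f' *c g') (hautV c))).
    rewrite convE linear_sweedler udeltaE hautVK.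
    by apply: eq_sw => x y; rewrite hmulE.
  by rewrite E linearZ /= haut1 -[in RHS](hautVK c) hcounit_haut.
by split=> -[/E ? /E ?].
Qed.

End ConvolutionTheory.

Section CoalgebraMaps.
Variables (k : fieldType).
Implicit Types (A B : homAlgType k) (C D : homCoalgType k).

Lemma lcomp_conv_along A B C (phi : {linear A -> B}) (M : lmodType k)
    (d : {linear M -> M \Ox C}) (f : {linear M -> A}) (g : {linear C -> A}) :
  ualg_map phi ->
  phi \oL conv_along d f g = conv_along d (phi \oL f) (phi \oL g).
Proof.
move=> [phiM _]; apply: linear_ext => m.
rewrite /= !conv_alongE linear_sweedler.
by apply: eq_sw => x y; rewrite phiM.
Qed.

Lemma lcomp_conv A B C (phi : {linear A -> B}) (f g : {linear C -> A}) :
  ualg_map phi -> phi \oL (f *c g) = (phi \oL f) *c (phi \oL g).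
Proof. exact: lcomp_conv_along. Qed.

Lemma lcomp_cst A B C (phi : {linear A -> B}) a :
  phi \oL cst C a = cst C (phi a).
Proof. by apply: linear_ext => c; rewrite /= linearZ. Qed.

Definition ucoalg_map C D (psi : {linear C -> D}) : Prop :=
  (forall c, udelta (psi c) = \sw_(x, y <- udelta c) psi x \ox psi y) /\
  (forall c, hcounit (psi c) = hcounit c).

Lemma conv_lcomp A C D (psi : {linear C -> D}) (f g : {linear D -> A}) :
  ucoalg_map psi -> (f *c g) \oL psi = (f \oL psi) *c (g \oL psi).
Proof.
move=> [psiD _]; apply: linear_ext => c.
rewrite /= !convE psiD sweedler_sw; [|lin..].
by apply: eq_sw => x y; rewrite sweedlerE //; lin.
Qed.

Lemma cst_lcomp A C D (psi : {linear C -> D}) (a : A) :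
  ucoalg_map psi -> cst D a \oL psi = cst C a.
Proof. by move=> [_ psie]; apply: linear_ext => c; rewrite /= psie. Qed.

Lemma ucoalg_haut C : ucoalg_map (haut : {linear C -> C}).
Proof.
split=> c; last exact: hcounit_haut.
by rewrite udeltaE hcomul_haut -udeltaE.
Qed.

Lemma ucoalg_hautV C : ucoalg_map (hautV : {linear C -> C}).
Proof.
split=> c; last by rewrite -[RHS](congr1 hcounit (hautVK c)) hcounit_haut.
rewrite -[in RHS](hautVK c) udelta_haut; [|lin..].
by rewrite -[LHS]sweedler_id; apply: eq_sw => x y; rewrite !hautK.
Qed.

Lemma lcompA (M N P Q : lmodType k) (h : {linear P -> Q}) (g : {linear N -> P})
  (f : {linear M -> N}) : h \oL (g \oL f) = (h \oL g) \oL f.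
Proof. exact: linear_ext. Qed.

End CoalgebraMaps.

(** * The tensor product of two Hom-coalgebras *)

Lemma hcoassoc_sw (k : fieldType) (C : homCoalgType k) (c : C) (P : lmodType k)
    (f : C -> C -> C -> P) :
  (forall y z, linear (fun x => f x y z)) ->
  (forall x z, linear (fun y => f x y z)) ->
  (forall x y, linear (f x y)) ->
  \sw_(x, y <- hcomul c) \sw_(z, w <- hcomul y) f (hautV x) z w
  = \sw_(x, y <- hcomul c) \sw_(z, w <- hcomul x) f z w (hautV y).
Proof. exact: trilinear_coassoc (hcomulA c). Qed.

Section TensorCoalgebra.
Variables (k : fieldType) (C D : homCoalgType k).

Definition tens_comul_fun (c : C) (d : D) : (C \Ox D) \Ox (C \Ox D) :=
  \sw_(c1, c2 <- hcomul c) \sw_(d1, d2 <- hcomul d) (c1 \ox d1) \ox (c2 \ox d2).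

Lemma tens_comul_linearl d : linear (tens_comul_fun^~ d).
Proof. rewrite /tens_comul_fun; lin. Qed.

Lemma tens_comul_linearr c : linear (tens_comul_fun c).
Proof. rewrite /tens_comul_fun; lin. Qed.

Definition tens_comul : {linear C \Ox D -> (C \Ox D) \Ox (C \Ox D)} :=
  tlift tens_comul_linearl tens_comul_linearr.

Lemma tens_comul_sw (c : C) (d : D) (P : lmodType k)
    (f : C \Ox D -> C \Ox D -> P) :
  (forall y, linear (f^~ y)) -> (forall x, linear (f x)) ->
  \sw_(x, y <- tens_comul (c \ox d)) f x y
  = \sw_(c1, c2 <- hcomul c) \sw_(d1, d2 <- hcomul d) f (c1 \ox d1) (c2 \ox d2).
Proof.
move=> fl fr; rewrite tliftE /tens_comul_fun sweedler_sw //; apply: eq_sw => x y.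
by rewrite sweedler_sw //; apply: eq_sw => z w; rewrite sweedlerE.
Qed.

Definition tens_counit_fun (c : C) (d : D) : k^o := hcounit c * hcounit d.

Lemma tens_counit_linearl d : linear (tens_counit_fun^~ d).
Proof.
by move=> a x y; rewrite /tens_counit_fun linearP mulrDl -mulrA.
Qed.

Lemma tens_counit_linearr c : linear (tens_counit_fun c).
Proof.
by move=> a x y; rewrite /tens_counit_fun linearP mulrDr [in LHS]mulrCA.
Qed.

Definition tens_counit : {scalar C \Ox D} :=
  tlift tens_counit_linearl tens_counit_linearr.

Lemma tens_counitE c d : tens_counit (c \ox d) = hcounit c * hcounit d.
Proof. exact: (tliftE tens_counit_linearl tens_counit_linearr). Qed.

Lemma tens_comulA (t : C \Ox D) :
  \sw_(t1, t2 <- tens_comul t) hautV t1 \ox tens_comul t2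
  = \sw_(t1, t2 <- tens_comul t) \sw_(t11, t12 <- tens_comul t1)
      t11 \ox (t12 \ox hautV t2).
Proof.
move: t; apply: tensor_ext => [||c d]; [lin..|].
rewrite !tens_comul_sw; [|lin..].
transitivity (\sw_(c1, c2 <- hcomul c) \sw_(c21, c22 <- hcomul c2)
  \sw_(d1, d2 <- hcomul d) \sw_(d21, d22 <- hcomul d2)
    (hautV c1 \ox hautV d1) \ox ((c21 \ox d21) \ox (c22 \ox d22))).
  apply: eq_sw => c1 c2; rewrite exchange_sw; apply: eq_sw => d1 d2.
  rewrite hautV_tens tliftE /tens_comul_fun tens_swr.
  by apply: eq_sw => c21 c22; rewrite tens_swr.
transitivity (\sw_(c1, c2 <- hcomul c) \sw_(c11, c12 <- hcomul c1)
  \sw_(d1, d2 <- hcomul d) \sw_(d11, d12 <- hcomul d1)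
    (c11 \ox d11) \ox ((c12 \ox d12) \ox (hautV c2 \ox hautV d2))); last first.
  apply: eq_sw => c1 c2; rewrite exchange_sw; apply: eq_sw => d1 d2.
  rewrite tens_comul_sw; [|lin..].
  by apply: eq_sw => c11 c12; rewrite hautV_tens.
rewrite (hcoassoc_sw c (f := fun c1 c2 c3 => \sw_(d1, d2 <- hcomul d)
  \sw_(d21, d22 <- hcomul d2)
    (c1 \ox hautV d1) \ox ((c2 \ox d21) \ox (c3 \ox d22)))); [|lin..].
apply: eq_sw => c1 c2; apply: eq_sw => c11 c12.
rewrite (hcoassoc_sw d (f := fun d1 d2 d3 =>
    (c11 \ox d1) \ox ((c12 \ox d2) \ox (hautV c2 \ox d3)))) //; lin.
Qed.

Lemma tens_counitr (t : C \Ox D) :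
  \sw_(t1, t2 <- tens_comul t) tens_counit t2 *: t1 = hautV t.
Proof.
move: t; apply: tensor_ext => [||c d]; [lin..|].
rewrite tens_comul_sw; [|lin..].
rewrite hautV_tens -!hcounitr tens_swl; apply: eq_sw => c1 c2.
rewrite tens_swr; apply: eq_sw => d1 d2.
by rewrite tens_counitE tens_scalel tens_scaler scalerA.
Qed.

Lemma tens_counitl (t : C \Ox D) :
  \sw_(t1, t2 <- tens_comul t) tens_counit t1 *: t2 = hautV t.
Proof.
move: t; apply: tensor_ext => [||c d]; [lin..|].
rewrite tens_comul_sw; [|lin..].
rewrite hautV_tens -!hcounitl tens_swl; apply: eq_sw => c1 c2.
rewrite tens_swr; apply: eq_sw => d1 d2.
by rewrite tens_counitE tens_scalel tens_scaler scalerA.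
Qed.

Lemma tens_comul_haut (t : C \Ox D) :
  tens_comul (haut t) = \sw_(t1, t2 <- tens_comul t) haut t1 \ox haut t2.
Proof.
move: t; apply: tensor_ext => [||c d]; [lin..|].
rewrite tens_comul_sw; [|lin..].
rewrite haut_tens tliftE /tens_comul_fun hcomul_sw; [|lin..].
apply: eq_sw => c1 c2; rewrite hcomul_sw; [|lin..].
by apply: eq_sw => d1 d2; rewrite !haut_tens.
Qed.

Lemma tens_counit_haut (t : C \Ox D) : tens_counit (haut t) = tens_counit t.
Proof.
move: t; apply: (tensor_ext (P := k^o)) => [||c d]; [lin..|].
by rewrite haut_tens !tens_counitE !hcounit_haut.
Qed.

HB.instance Definition _ := HomSpace_isHomCoalgebra.Build k (C \Ox D)
  tens_comulA tens_counitr tens_counitl tens_comul_haut tens_counit_haut.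

Lemma udelta_tens_sw (c : C) (d : D) (P : lmodType k)
    (f : C \Ox D -> C \Ox D -> P) :
  (forall y, linear (f^~ y)) -> (forall x, linear (f x)) ->
  \sw_(x, y <- udelta (c \ox d)) f x y
  = \sw_(c1, c2 <- udelta c) \sw_(d1, d2 <- udelta d) f (c1 \ox d1) (c2 \ox d2).
Proof.
by move=> fl fr; rewrite !udeltaE haut_tens; apply: tens_comul_sw.
Qed.

Lemma hcounit_tens (c : C) (d : D) : hcounit (c \ox d) = hcounit c * hcounit d.
Proof. exact: tens_counitE. Qed.

Lemma conv_tensE (A : homAlgType k) (f g : {linear C \Ox D -> A}) c d :
  (f *c g) (c \ox d) = \sw_(c1, c2 <- udelta c) \sw_(d1, d2 <- udelta d)
    f (c1 \ox d1) *o g (c2 \ox d2).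
Proof. by rewrite convE udelta_tens_sw //; lin. Qed.

Lemma projl_linear1 (d : D) : linear (fun c : C => hcounit d *: c).
Proof. lin. Qed.
Lemma projl_linear2 (c : C) : linear (fun d : D => hcounit d *: c).
Proof. lin. Qed.
Lemma projr_linear1 (d : D) : linear (fun c : C => hcounit c *: d).
Proof. lin. Qed.
Lemma projr_linear2 (c : C) : linear (fun d : D => hcounit c *: d).
Proof. lin. Qed.

(** The counit applied to one factor gives coalgebra maps [C \Ox D -> C] and
    [C \Ox D -> D]; precomposing with them turns a map of one variable into a
    map of two variables to which convolution applies. *)
Definition projl : {linear C \Ox D -> C} := tlift projl_linear1 projl_linear2.
Definition projr : {linear C \Ox D -> D} := tlift projr_linear1 projr_linear2.

Lemma projlE c d : projl (c \ox d) = hcounit d *: c.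
Proof. exact: tliftE. Qed.

Lemma projrE c d : projr (c \ox d) = hcounit c *: d.
Proof. exact: tliftE. Qed.

Lemma ucoalg_projl : ucoalg_map projl.
Proof.
split; [|apply: (tensor_ext (P := k^o)) => [||c d]; [lin..|]]; last first.
  by rewrite projlE hcounit_tens linearZ /= mulrC.
apply: tensor_ext => [||c d]; [lin..|].
rewrite projlE udelta_tens_sw; [|lin..].
rewrite linearZ -[in LHS](sweedler_id (udelta c)) /= scale_sw.
apply: eq_sw => c1 c2.
rewrite -(counitl_sw d (f := fun y => hcounit y *: (c1 \ox c2))); last by lin.
by apply: eq_sw => d1 d2; rewrite !projlE tens_scalel tens_scaler.
Qed.

Lemma ucoalg_projr : ucoalg_map projr.
Proof.
split; [|apply: (tensor_ext (P := k^o)) => [||c d]; [lin..|]]; last first.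
  by rewrite projrE hcounit_tens linearZ.
apply: tensor_ext => [||c d]; [lin..|].
rewrite projrE udelta_tens_sw; [|lin..].
rewrite exchange_sw.
rewrite linearZ -[in LHS](sweedler_id (udelta d)) /= scale_sw.
apply: eq_sw => d1 d2.
rewrite -(counitl_sw c (f := fun y => hcounit y *: (d1 \ox d2))); last by lin.
by apply: eq_sw => c1 c2; rewrite !projrE tens_scalel tens_scaler.
Qed.

Lemma conv_projlr (A : homAlgType k) (f : {linear C -> A}) (g : {linear D -> A}) c d :
  ((f \oL projl) *c (g \oL projr)) (c \ox d) = f c *o g d.
Proof.
rewrite conv_tensE.
rewrite -(counitr_sw c (f := fun x => f x *o g d)); last by lin.
apply: eq_sw => c1 c2.
rewrite -(counitl_sw d (f := fun y => f c1 *o g y)); last by lin.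
rewrite scale_sw; apply: eq_sw => d1 d2.
by rewrite /= projlE projrE !linearZ /= umulZl umulZr scalerA mulrC -scalerA.
Qed.

(** Compare with [conv_projlr]: maps of different variables commute under
    convolution as soon as their values commute. *)
Lemma conv_projrl (A : homAlgType k) (f : {linear C -> A}) (g : {linear D -> A}) c d :
  ((g \oL projr) *c (f \oL projl)) (c \ox d) = g d *o f c.
Proof.
rewrite conv_tensE.
rewrite -(counitl_sw c (f := fun x => g d *o f x)); last by lin.
apply: eq_sw => c1 c2.
rewrite -(counitr_sw d (f := fun y => g y *o f c2)); last by lin.
rewrite scale_sw; apply: eq_sw => d1 d2.
by rewrite /= projlE projrE !linearZ /= umulZl umulZr scalerA mulrC -scalerA.
Qed.

End TensorCoalgebra.
Arguments projl {k C D}.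
Arguments projr {k C D}.

Lemma conv_inverse2P (k : fieldType) (C : homCoalgType k) (A : homAlgType k)
    (f g : {linear C \Ox C -> A}) :
  conv_inverse2 f g <-> conv_inverse f g.
Proof.
have E (f' g' : {linear C \Ox C -> A}) c d :
    \sw_(x, y <- hcomul (c \ox d)) f' x *h g' y
    = \sw_(c1, c2 <- hcomul c) \sw_(d1, d2 <- hcomul d)
        f' (c1 \ox d1) *h g' (c2 \ox d2) :> A.
  by apply: (tens_comul_sw c d (f := fun x y => f' x *h g' y)); lin.
split=> -[fg gf].
  by split; (apply: tensor_ext => [||c d]; [lin..|]);
    rewrite E ?fg ?gf hcounit_tens.
by split=> c d; rewrite -E ?fg ?gf hcounit_tens.
Qed.

Section HopfMultiplication.
Variables (k : fieldType) (H : homHopfType k).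

Lemma ucoalg_umul : ucoalg_map (@umul k H).
Proof.
split; [|apply: (tensor_ext (P := k^o)) => [||g h]; [lin..|]]; last first.
  by rewrite hcounit_tens umulE -hcounitM -[LHS]hcounit_haut hautVK.
apply: tensor_ext => [||g h]; [lin..|].
rewrite udelta_tens_sw; [|lin..].
rewrite udeltaE umulE hautVK hcomulM.
have E (c : H) : haut (hcomul c) = udelta c.
  rewrite udeltaE hcomul_haut -[in LHS](sweedler_id (hcomul c)) linear_sweedler.
  by apply: eq_sw => x y; rewrite haut_tens.
rewrite hmulE haut_umul !E.
rewrite -[in LHS](sweedler_id (udelta g)) tens_swl linear_sweedler.
apply: eq_sw => g1 g2.
rewrite -[in LHS](sweedler_id (udelta h)) tens_swr linear_sweedler.
by apply: eq_sw => h1 h2; rewrite umul_tens.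
Qed.

End HopfMultiplication.

(** * Convolution inverses *)

Section ConvolutionInverse.
Variable k : fieldType.
Implicit Types (A B : homAlgType k) (C D : homCoalgType k).

Lemma cinv_sym C A (f g : {linear C -> A}) : cinv f g -> cinv g f.
Proof. by case. Qed.

Lemma cinv_uniq C A (f g h : {linear C -> A}) : cinv f g -> cinv f h -> g = h.
Proof. by move=> [_ gf] [fh _]; apply: conv_inv_uniq fh. Qed.

Lemma cinvM C A (f f' g g' : {linear C -> A}) :
  cinv f f' -> cinv g g' -> cinv (f *c g) (g' *c f').
Proof.
move=> [ff' f'f] [gg' g'g]; split.
  by rewrite convA -(convA f) gg' convf1.
by rewrite convA -(convA g') f'f convf1.
Qed.

Lemma cinv_cst C A (a b : A) : a *o b = hone -> b *o a = hone ->
  cinv (cst C a) (cst C b).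
Proof. by move=> ab ba; split; rewrite conv_cst ?ab ?ba. Qed.

Lemma cinv_lcomp C A B (phi : {linear A -> B}) (f g : {linear C -> A}) :
  ualg_map phi -> cinv f g -> cinv (phi \oL f) (phi \oL g).
Proof.
move=> phiP [fg gf]; have [_ phi1] := phiP.
by split; rewrite -lcomp_conv // ?fg ?gf lcomp_cst phi1.
Qed.

Lemma lcomp_cinv C D A (psi : {linear D -> C}) (f g : {linear C -> A}) :
  ucoalg_map psi -> cinv f g -> cinv (f \oL psi) (g \oL psi).
Proof.
by move=> psiP [fg gf]; split; rewrite -conv_lcomp // ?fg ?gf cst_lcomp.
Qed.

Lemma conv_projlE C D A (f : {linear C -> A}) (g : {linear C \Ox D -> A}) c d :
  ((f \oL projl) *c g) (c \ox d) = \sw_(x, y <- udelta c) f x *o g (y \ox d).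
Proof.
rewrite conv_tensE; apply: eq_sw => c1 c2.
rewrite -(counitl_sw d (f := fun y => f c1 *o g (c2 \ox y))); last by lin.
by apply: eq_sw => d1 d2; rewrite /= projlE linearZ umulZl.
Qed.

(** Conjugation by the automorphisms respects convolution, hence maps the
    inverse of [f] to the inverse of the conjugate of [f], which is [f]. *)
Lemma cinv_equivariant C A (f g : {linear C -> A}) :
  cinv f g -> (forall c, f (haut c) = haut (f c)) ->
  forall c, g (haut c) = haut (g c).
Proof.
move=> fg fE c.
have f_inv : cinv f (hautV \oL (g \oL haut)).
  rewrite (_ : f = hautV \oL (f \oL haut)).
    apply: cinv_lcomp (ualg_hautV A) _; apply: lcomp_cinv fg.
    exact: ucoalg_haut.
  by apply: linear_ext => x; rewrite /= fE hautK.
by rewrite [in RHS](cinv_uniq fg f_inv) /= hautVK.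
Qed.

Variable H : homHopfType k.

Lemma cinv_antipode : cinv (lid H) antipode.
Proof.
by apply/conv_inverseP; split=> h; [apply: antipoder | apply: antipodel].
Qed.

End ConvolutionInverse.

(** * Comodule algebras and coinvariants *)

Section UntwistedCoaction.
Variables (k : fieldType) (H : homHopfType k) (B : homComodAlgType H).

Definition urho : {linear B -> B \Ox H} := locked (hcoact \oL haut).

Lemma urhoE b : urho b = hcoact (haut b).
Proof. by rewrite /urho; unlock. Qed.

Local Notation tl := (tensl B H).
Local Notation tr := (tensr B H).

Lemma ualg_urho : ualg_map urho.
Proof.
have [_ rhoP] := (hom_algebra_map_ualg _).1 (@hcoact_algebra_map k H B).
have := ualg_comp (ualg_haut B) rhoP.
by move=> [M O]; split=> *; rewrite !urhoE; [apply: M | apply: O].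
Qed.

Lemma hcoact_haut_sw (b : B) (P : lmodType k) (f : B -> H -> P) :
  (forall y, linear (f^~ y)) -> (forall x, linear (f x)) ->
  \sw_(x, y <- hcoact (haut b)) f x y = \sw_(x, y <- hcoact b) f (haut x) (haut y).
Proof.
move=> fl fr; have [_ _ ->] := @hcoact_comodule k H B.
rewrite sweedler_sw //.
by apply: eq_sw => x y; rewrite sweedlerE.
Qed.

Lemma urho_haut_sw (b : B) (P : lmodType k) (f : B -> H -> P) :
  (forall y, linear (f^~ y)) -> (forall x, linear (f x)) ->
  \sw_(x, y <- urho (haut b)) f x y = \sw_(x, y <- urho b) f (haut x) (haut y).
Proof. by move=> fl fr; rewrite !urhoE hcoact_haut_sw. Qed.

Lemma urho_haut b : urho (haut b) = haut (urho b).
Proof. by rewrite !urhoE; have [-> _ _] := @hcoact_algebra_map k H B. Qed.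

Lemma ucomodule_urho : ucomodule urho.
Proof.
have [coA cou _] := @hcoact_comodule k H B; split=> b; last first.
  by rewrite urhoE cou hautK.
have := coA (haut (haut b)); rewrite -!urhoE.
rewrite (urho_haut_sw _ (f := fun x y => hautV x \ox hcomul y)); [|lin..].
rewrite (urho_haut_sw _ (f := fun x y => \sw_(z, w <- hcoact x) z \ox (w \ox hautV y)));
  [|lin..].
under eq_sw => x y do rewrite hautK -udeltaE.
move=> ->; apply: eq_sw => x y; rewrite -urhoE.
by apply: eq_sw => z w; rewrite hautK.
Qed.

Lemma urho_conv : urho = conv_along urho tl tr.
Proof.
apply: linear_ext => b; rewrite conv_alongE -[LHS]sweedler_id.
by apply: eq_sw => x y; rewrite tenslrE.
Qed.

Lemma coinvariant_urhoP b : b \in @coinvariant k H B <-> urho b = tl b.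
Proof.
split=> [/coinvariantP E | E].
  rewrite urhoE; have [-> _ _] := @hcoact_algebra_map k H B.
  by rewrite E haut_tens hautVK haut1.
apply/coinvariantP; rewrite -[in LHS](hautVK b) -urhoE.
by apply: (can_inj (@hautK k _)); rewrite -urho_haut hautVK E haut_tens hautVK haut1.
Qed.

Lemma comodule_mapP (gamma : {linear H -> B}) :
  hom_comodule_map hcomul hcoact gamma <->
  (forall h, gamma (haut h) = haut (gamma h)) /\
  urho \oL gamma = (tl \oL gamma) *c tr.
Proof.
split=> -[gE gD]; split=> //.
  apply: linear_ext => h; rewrite /= urhoE -gE gD convE udeltaE.
  by apply: eq_sw => x y; rewrite tenslrE.
move=> h; have := congr1 (fun f : {linear H -> B \Ox H} => f (hautV h)) gD.
rewrite /= urhoE -gE hautVK convE udeltaE hautVK => ->.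
by apply: eq_sw => x y; rewrite tenslrE.
Qed.

Definition coinv_incl : {linear coinv B -> B} :=
  locked (val : {linear coinv B -> B}).

Lemma coinv_inclE a : coinv_incl a = val a.
Proof. by rewrite /coinv_incl; unlock. Qed.

Lemma coinv_incl_haut (a : coinv B) : coinv_incl (haut a) = haut (coinv_incl a).
Proof. by rewrite !coinv_inclE. Qed.

Lemma coinv_incl_hmul (a b : coinv B) :
  coinv_incl (a *h b) = coinv_incl a *h coinv_incl b.
Proof. by rewrite !coinv_inclE; apply: val_coinv_mul. Qed.

Lemma ualg_coinv_incl : ualg_map coinv_incl.
Proof.
apply: (proj2 ((hom_algebra_map_ualg _).1 _)).
by split; [apply: coinv_incl_haut | apply: coinv_incl_hmul | rewrite coinv_inclE].
Qed.

Lemma coinv_incl_inj : injective coinv_incl.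
Proof. by move=> a b; rewrite !coinv_inclE => /val_inj. Qed.

Section Corestriction.
Variables (M : lmodType k) (f : {linear M -> B}).
Hypothesis fP : forall m, f m \in @coinvariant k H B.

Lemma corestr_linear : linear (fun m => Coinv (fP m)).
Proof. by move=> c x y; apply: val_inj; rewrite /= linearP. Qed.

Definition corestr : {linear M -> coinv B} := mklin corestr_linear.

Lemma corestrE : coinv_incl \oL corestr = f.
Proof. by apply: linear_ext => m; rewrite /= coinv_inclE. Qed.

End Corestriction.

End UntwistedCoaction.
Arguments urho {k H B}.
Arguments coinv_incl {k H B}.

(** The axioms of a Hom-algebra are equations, so they can be checked after an
    injective map that preserves the operations. A crossed
    product thus inherits its cocycle and twisted module conditions from
    associativity in [B]. *)
Lemma hom_algebra_inj (k : fieldType) (V : homSpaceType k) (B : homAlgType k)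
    (mul : {linear V \Ox V -> V}) (one : V) (f : {linear V -> B}) :
  injective f -> (forall v, f (haut v) = haut (f v)) ->
  (forall u v, f (mul (u \ox v)) = f u *h f v) -> f one = hone ->
  hom_algebra mul one.
Proof.
move=> f_inj fE fM f1; split=> *; apply: f_inj; rewrite ?(fE, fM, f1) //.
- exact: hmulA.
- exact: hmulr1.
- exact: hmul1r.
- exact: hautM.
- exact: haut1.
Qed.

(** * From a cleft extension to a crossed product *)

Section CleftToCrossed.
Variables (k : fieldType) (H : homHopfType k) (B : homComodAlgType H).

Local Notation tl := (tensl B H).
Local Notation tr := (tensr B H).
Local Notation trS := (tensr B H \oL antipode).
Local Notation A := (coinv B).

(** [rho] is an algebra map, so [rho o gammaV] is inverse to
    [rho o gamma = (tl o gamma) * tr], and the inverse of a product is the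
    product of the inverses in the opposite order. *)
Lemma urho_cinv (gamma gammaV : {linear H -> B}) :
  urho \oL gamma = (tl \oL gamma) *c tr -> cinv gamma gammaV ->
  urho \oL gammaV = trS *c (tl \oL gammaV).
Proof.
move=> gD gV; apply: cinv_uniq (cinv_lcomp (ualg_urho B) gV) _; rewrite gD.
apply: cinvM (cinv_lcomp (ualg_tensl B H) gV) _.
have := cinv_lcomp (ualg_tensr B H) (cinv_antipode H).
by rewrite (_ : tr \oL lid H = tr) //; apply: linear_ext.
Qed.

Lemma conv_tr_trS : tr *c trS = cst H hone.
Proof.
have [+ _] := cinv_lcomp (ualg_tensr B H) (cinv_antipode H).
by rewrite (_ : tr \oL lid H = tr) //; apply: linear_ext.
Qed.

Variables gamma gammaV : {linear H -> B}.
Hypothesis gammaE : forall h, gamma (haut h) = haut (gamma h).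
Hypothesis gammaD : urho \oL gamma = (tl \oL gamma) *c tr.
Hypothesis gammaK : cinv gamma gammaV.
Hypothesis gamma1 : gamma hone = hone.

Let gammaVD : urho \oL gammaV = trS *c (tl \oL gammaV).
Proof. exact: urho_cinv gammaD gammaK. Qed.

Let gammaVE h : gammaV (haut h) = haut (gammaV h).
Proof. exact: cinv_equivariant gammaK gammaE h. Qed.

(** The untwisted action of [h] on [a], conjugation by [gamma]. *)
Definition cleft_conj (a : B) : {linear H -> B} := gamma *c cst H a *c gammaV.

Lemma cleft_conjE a h :
  cleft_conj a h = \sw_(x, y <- udelta h) (gamma x *o a) *o gammaV y.
Proof.
rewrite /cleft_conj -convA convE; apply: eq_sw => x y.
by rewrite conv_cstl umulA.
Qed.

(** Under [rho] the word [gamma * a * gammaV] becomes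
    [(tl o gamma) * tr * tl a * (tr o S) * (tl o gammaV)]; as [tr] commutes with
    [tl a], the two middle factors [tr] and [tr o S] cancel. *)
Lemma cleft_conj_coinv a h :
  a \in @coinvariant k H B -> cleft_conj a h \in @coinvariant k H B.
Proof.
move=> /coinvariant_urhoP aP; apply/coinvariant_urhoP.
suff: urho \oL cleft_conj a = tl \oL cleft_conj a.
  by move/(congr1 (fun f : {linear H -> B \Ox H} => f h)).
rewrite /cleft_conj !(lcomp_conv _ _ (ualg_urho B)).
rewrite !(lcomp_conv _ _ (ualg_tensl B H)).
rewrite !lcomp_cst aP gammaD gammaVD -!convA; congr (_ *c _).
have -> : tr *c (cst H (tl a) *c (trS *c (tl \oL gammaV)))
    = cst H (tl a) *c (tr *c (trS *c (tl \oL gammaV))).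
  rewrite !convA; congr (_ *c _ *c _).
  by apply: linear_ext => x; rewrite conv_cstl conv_cstr tenslr_comm.
by congr (_ *c _); rewrite convA conv_tr_trS conv1f.
Qed.

Lemma cleft_conj_haut a h : haut (cleft_conj a h) = cleft_conj (haut a) (haut h).
Proof.
rewrite !cleft_conjE udelta_haut; [|lin..].
rewrite linear_sweedler; apply: eq_sw => x y.
by rewrite !haut_umul gammaE gammaVE.
Qed.

Lemma cleft_conj1 : cleft_conj hone = cst H hone.
Proof. by have [gg _] := gammaK; rewrite /cleft_conj convf1. Qed.

Lemma cleft_conjM a b : cleft_conj (a *o b) = cleft_conj a *c cleft_conj b.
Proof.
have [_ gg] := gammaK.
rewrite /cleft_conj -conv_cst -!convA; congr (_ *c (_ *c _)).
by rewrite (convA gammaV) gg conv1f.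
Qed.

Lemma cleft_act_linearl (a : A) :
  linear (fun h => haut (corestr (fun h => cleft_conj_coinv h (valP a)) h)).
Proof. lin. Qed.

Lemma cleft_act_linearr (h : H) :
  linear (fun a : A => haut (corestr (fun h => cleft_conj_coinv h (valP a)) h)).
Proof.
have l : linear (fun a : A =>
    haut (\sw_(x, y <- udelta h) (gamma x *o coinv_incl a) *o gammaV y) : B) by lin.
have E (a : A) : coinv_incl (haut (corestr (fun h => cleft_conj_coinv h (valP a)) h))
    = haut (\sw_(x, y <- udelta h) (gamma x *o coinv_incl a) *o gammaV y).
  by rewrite -cleft_conjE !coinv_inclE.
move=> c a b; apply: coinv_incl_inj; rewrite [RHS]linearP !E.
exact: l.
Qed.

(** The additional [haut] comes from the multiplication of the crossed product,
    where the action enters twisted by one power of the automorphism. *)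
Definition cleft_act : {linear H \Ox A -> A} :=
  tlift cleft_act_linearl cleft_act_linearr.

Lemma cleft_actE h (a : A) :
  coinv_incl (cleft_act (h \ox a)) = haut (cleft_conj (coinv_incl a) h).
Proof. by rewrite tliftE !coinv_inclE. Qed.

Lemma cleft_act_weak : weak_action cleft_act.
Proof.
have [inclM incl1] := ualg_coinv_incl B.
split.
- move=> h a; apply: coinv_incl_inj.
  by rewrite coinv_incl_haut !cleft_actE coinv_incl_haut cleft_conj_haut.
- move=> h; apply: coinv_incl_inj.
  by rewrite cleft_actE linearZ /= incl1 cleft_conj1 /= linearZ /= haut1.
- move=> h a b; apply: coinv_incl_inj.
  rewrite cleft_actE [RHS]linear_sweedler.
  rewrite hmulE coinv_incl_haut inclM haut_umul cleft_conjM convE.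
  rewrite -[in LHS](hautVK h) udelta_haut; [|lin..].
  rewrite udeltaE hautVK linear_sweedler; apply: eq_sw => x y.
  rewrite haut_umul hmulE coinv_incl_haut inclM haut_umul.
  by rewrite !cleft_actE !cleft_conj_haut.
Qed.

(** In Sweedler notation,
    [sigma(g, h) = gamma(g_1) gamma(h_1) gammaV(g_2 h_2)]. *)
Definition cleft_sigma : {linear H \Ox H -> B} :=
  (gamma \oL projl) *c (gamma \oL projr) *c (gammaV \oL @umul k H).

(** Under [rho] the factors [tr] of the two copies of [gamma] can be moved next
    to each other, since maps of different variables with commuting values
    commute. Their product is [tr] of the product of [H], which cancels
    against the [tr o S] of [gammaV]. *)
Lemma cleft_sigma_coinv t : cleft_sigma t \in @coinvariant k H B.
Proof.
apply/coinvariant_urhoP.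
suff: urho \oL cleft_sigma = tl \oL cleft_sigma.
  by move/(congr1 (fun f : {linear H \Ox H -> B \Ox H} => f t)).
rewrite /cleft_sigma !(lcomp_conv _ _ (ualg_urho B)).
rewrite !(lcomp_conv _ _ (ualg_tensl B H)).
rewrite !lcompA gammaD gammaVD.
rewrite (conv_lcomp _ _ (ucoalg_projl H H)) (conv_lcomp _ _ (ucoalg_projr H H)).
rewrite (conv_lcomp _ _ (ucoalg_umul H)) -!convA; congr (_ *c _).
have -> (f : {linear H \Ox H -> B \Ox H}) :
    (tr \oL projl) *c (((tl \oL gamma) \oL projr) *c f)
    = ((tl \oL gamma) \oL projr) *c ((tr \oL projl) *c f).
  rewrite !convA; congr (_ *c _); apply: linear_ext.
  apply: tensor_ext => [||g h]; [lin..|].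
  by rewrite conv_projlr conv_projrl /lcomp [RHS]tenslr_comm.
congr (_ *c _).
have -> : (tr \oL projl) *c ((tr \oL projr) *c
    ((trS \oL @umul k H) *c ((tl \oL gammaV) \oL @umul k H)))
  = ((tr *c trS) \oL @umul k H) *c ((tl \oL gammaV) \oL @umul k H).
  rewrite (conv_lcomp _ _ (ucoalg_umul H)) !convA.
  congr (_ *c _ *c _); apply: linear_ext.
  apply: tensor_ext => [||g h]; [lin..|].
  by rewrite conv_projlr /lcomp /= umul_tens umulr1.
by rewrite conv_tr_trS (cst_lcomp _ (ucoalg_umul H)) conv1f.
Qed.

Definition cleft_sigmaV : {linear H \Ox H -> B} :=
  (gamma \oL @umul k H) *c ((gammaV \oL projr) *c (gammaV \oL projl)).

Lemma cleft_sigmaK : cinv cleft_sigma cleft_sigmaV.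
Proof.
apply: cinvM; last exact: lcomp_cinv (ucoalg_umul H) (cinv_sym gammaK).
by apply: cinvM; apply: lcomp_cinv gammaK;
  [apply: ucoalg_projl | apply: ucoalg_projr].
Qed.

(** [rho o sigma = tl o sigma] forces the same of the inverse, by uniqueness of
    convolution inverses. *)
Lemma cleft_sigmaV_coinv t : cleft_sigmaV t \in @coinvariant k H B.
Proof.
apply/coinvariant_urhoP.
suff: urho \oL cleft_sigmaV = tl \oL cleft_sigmaV.
  by move/(congr1 (fun f : {linear H \Ox H -> B \Ox H} => f t)).
have s : urho \oL cleft_sigma = tl \oL cleft_sigma.
  by apply: linear_ext => u; apply/coinvariant_urhoP/cleft_sigma_coinv.
apply: cinv_uniq (cinv_lcomp (ualg_urho B) cleft_sigmaK) _.
by rewrite s; apply: cinv_lcomp (ualg_tensl B H) cleft_sigmaK.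
Qed.

Definition cleft_cocycle : {linear H \Ox H -> A} :=
  haut \oL corestr cleft_sigma_coinv.

(** The inclusion of the coinvariants is injective and preserves products and
    identities, so convolution equations can be read in [B]. *)
Lemma cinv_coinv (C : homCoalgType k) (f g : {linear C -> A}) :
  cinv (coinv_incl \oL f) (coinv_incl \oL g) -> cinv f g.
Proof.
have [_ i1] := ualg_coinv_incl B.
rewrite /cinv -!(lcomp_conv _ _ (ualg_coinv_incl B)) => -[fg gf].
split; apply: linear_ext => c; apply: coinv_incl_inj.
  by have := congr1 (fun f : {linear C -> B} => f c) fg; rewrite /= linearZ /= i1.
by have := congr1 (fun f : {linear C -> B} => f c) gf; rewrite /= linearZ /= i1.
Qed.

Lemma cleft_cocycle_inv : exists cocycleV, conv_inverse2 cleft_cocycle cocycleV.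
Proof.
exists (haut \oL corestr cleft_sigmaV_coinv).
apply/conv_inverse2P/conv_inverseP.
apply: cinv_lcomp (ualg_haut _) _; apply: cinv_coinv.
by rewrite !corestrE; apply: cleft_sigmaK.
Qed.

Lemma cleft_sigma_haut t : haut (cleft_sigma t) = cleft_sigma (haut t).
Proof.
suff E : haut \oL cleft_sigma = cleft_sigma \oL haut.
  by move/(congr1 (fun f : {linear H \Ox H -> B} => f t)): E.
rewrite /cleft_sigma !(lcomp_conv _ _ (ualg_haut B)).
rewrite !(conv_lcomp _ _ (ucoalg_haut _)).
congr (_ *c _ *c _); apply: linear_ext; apply: tensor_ext => [||g h];
  try lin; rewrite /= ?haut_tens.
- by rewrite !projlE hcounit_haut !linearZ /= gammaE.
- by rewrite !projrE hcounit_haut !linearZ /= gammaE.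
- by rewrite -haut_umul gammaVE.
Qed.

(** [p1 b p1^-1 * (p1 p2 q^-1) * q = p1 b p2]. *)
Lemma cleft_sigma_twist b :
  (cleft_conj b \oL projl) *c (cleft_sigma *c (gamma \oL @umul k H))
  = (gamma \oL projl) *c (cst _ b *c (gamma \oL projr)).
Proof.
have [_ gg] := gammaK.
have E : (gammaV \oL @umul k H) *c (gamma \oL @umul k H) = cst _ hone.
  by rewrite -(conv_lcomp _ _ (ucoalg_umul H)) gg (cst_lcomp _ (ucoalg_umul H)).
rewrite /cleft_sigma -(convA _ (gammaV \oL _)) E convf1.
rewrite /cleft_conj !(conv_lcomp _ _ (ucoalg_projl H H)).
rewrite (cst_lcomp _ (ucoalg_projl H H)).
rewrite -!convA; congr (_ *c (_ *c _)).
rewrite convA -(conv_lcomp _ _ (ucoalg_projl H H)) gg.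
by rewrite (cst_lcomp _ (ucoalg_projl H H)) conv1f.
Qed.

Lemma gamma_mulE b g h :
  gamma g *o (b *o gamma h)
  = \sw_(g1, g2 <- udelta g) \sw_(g21, g22 <- udelta g2) \sw_(h1, h2 <- udelta h)
      cleft_conj b g1 *o (cleft_sigma (g21 \ox h1) *o gamma (g22 *o h2)).
Proof.
have := congr1 (fun f : {linear H \Ox H -> B} => f (g \ox h)) (cleft_sigma_twist b).
rewrite conv_projlE [RHS]conv_projlE.
under [RHS]eq_sw => x y do rewrite conv_cstl /= projrE linearZ !umulZr.
rewrite [RHS](counitr_sw g (f := fun x => gamma x *o (b *o gamma h))); last by lin.
move=> <-; apply: eq_sw => g1 g2; rewrite conv_tensE tens_swr linear_sweedler.
by apply: eq_sw => g21 g22; rewrite tens_swr linear_sweedler.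
Qed.

Lemma cleft_iso_linearl (h : H) : linear (fun a : A => coinv_incl a *h gamma h).
Proof. lin. Qed.

Lemma cleft_iso_linearr (a : A) : linear (fun h : H => coinv_incl a *h gamma h).
Proof. lin. Qed.

Definition cleft_iso : {linear A \Ox H -> B} :=
  tlift cleft_iso_linearl cleft_iso_linearr.

Lemma cleft_isoE (a : A) h : cleft_iso (a \ox h) = coinv_incl a *h gamma h.
Proof. exact: tliftE. Qed.

(** Both sides are [haut (haut (a *o _))] of the two sides of [gamma_mulE]; what
    remains is to distribute the automorphisms over the twisted formula. *)
Lemma cleft_isoM t u :
  cleft_iso (crossed_mul cleft_act cleft_cocycle (t \ox u))
  = cleft_iso t *h cleft_iso u.
Proof.
move: t; apply: tensor_ext => [||a g]; [lin..|].
move: u; apply: tensor_ext => [||b h]; [lin..|].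
rewrite crossed_mulE !cleft_isoE !linear_sweedler.
transitivity (haut (haut (coinv_incl a *o
  (gamma g *o (coinv_incl b *o gamma h))))); last first.
  by rewrite !hmulE -haut_umul !umulA.
rewrite gamma_mulE udelta_sw; [|lin..].
rewrite tens_swr !linear_sweedler; apply: eq_sw => g1 g2.
rewrite udelta_haut; [|lin..].
rewrite udelta_sw; [|lin..].
rewrite tens_swr !linear_sweedler; apply: eq_sw => g21 g22.
rewrite udelta_sw; [|lin..].
rewrite tens_swr !linear_sweedler; apply: eq_sw => h1 h2.
rewrite cleft_isoE.
have [inclM _] := ualg_coinv_incl B.
rewrite !hmulE !(coinv_incl_haut, inclM, haut_umul, cleft_actE).
have sE t : coinv_incl (corestr cleft_sigma_coinv t) = cleft_sigma t.
  by rewrite coinv_inclE.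
rewrite !sE -!gammaE !(cleft_conj_haut, cleft_sigma_haut, haut_tens, haut_umul).
by rewrite -!coinv_incl_haut !hautVK !umulA.
Qed.

Lemma cleft_iso_haut t : cleft_iso (haut t) = haut (cleft_iso t).
Proof.
move: t; apply: tensor_ext => [||a h]; [lin..|].
by rewrite haut_tens !cleft_isoE gammaE coinv_incl_haut hautM.
Qed.

Lemma cleft_iso1 : cleft_iso (hone \ox hone) = hone.
Proof.
have [_ incl1] := ualg_coinv_incl B.
by rewrite cleft_isoE gamma1 incl1 hmulr1 haut1.
Qed.

(** The [A]-component of [b] under the inverse isomorphism,
    [b_0 gammaV(b_1)]. *)
Definition cleft_proj : {linear B -> B} := conv_along urho (lid B) gammaV.

Lemma cleft_proj_coinv b : cleft_proj b \in @coinvariant k H B.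
Proof.
apply/coinvariant_urhoP.
suff: urho \oL cleft_proj = tl \oL cleft_proj.
  by move/(congr1 (fun f : {linear B -> B \Ox H} => f b)).
rewrite /cleft_proj (lcomp_conv_along _ _ _ (ualg_urho B)).
rewrite (lcomp_conv_along _ _ _ (ualg_tensl B H)).
have lidE (f : {linear B -> B \Ox H}) : f \oL lid B = f by apply: linear_ext.
rewrite !lidE gammaVD [X in conv_along _ X _]urho_conv.
rewrite -(conv_along_conv _ _ _ (ucomodule_urho B)).
by rewrite convA conv_tr_trS conv1f.
Qed.

(** [(id * gammaV) * gamma = id], convolutions being taken along [rho]. *)
Lemma cleft_projK b : \sw_(x, y <- urho b) cleft_proj x *o gamma y = b.
Proof.
rewrite -conv_alongE -(conv_along_conv _ _ _ (ucomodule_urho B)).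
have [_ ->] := gammaK.
by rewrite (conv_along_cst _ _ _ (ucomodule_urho B)) umulr1.
Qed.

Lemma urho_mul_gamma (a : A) h (P : lmodType k) (f : B -> H -> P) :
  (forall y, linear (f^~ y)) -> (forall x, linear (f x)) ->
  \sw_(x, y <- urho (coinv_incl a *o gamma h)) f x y
  = \sw_(x, y <- udelta h) f (coinv_incl a *o gamma x) y.
Proof.
move=> fl fr; have [urhoM _] := ualg_urho B.
have aE : urho (coinv_incl a) = tl (coinv_incl a).
  by apply/coinvariant_urhoP; rewrite coinv_inclE; apply: valP.
have hE := congr1 (fun f : {linear H -> B \Ox H} => f h) gammaD.
rewrite /= in hE; rewrite urhoM aE hE convE tens_swr linear_sweedler.
rewrite sweedler_sw //; apply: eq_sw => x y.
by rewrite tenslrE umul_tens umul1r sweedlerE.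
Qed.

Lemma cleft_proj_mul (a : A) h :
  cleft_proj (coinv_incl a *o gamma h) = hcounit h *: coinv_incl a.
Proof.
rewrite /cleft_proj conv_alongE urho_mul_gamma; [|lin..].
have [gg _] := gammaK.
have := congr1 (fun f : {linear H -> B} => coinv_incl a *o f h) gg.
rewrite convE tens_swr linear_sweedler /= umulZr umulr1 => <-.
by apply: eq_sw => x y; rewrite umulA.
Qed.

(** [hautV] compensates for the twisted product in [cleft_iso]. *)
Definition cleft_isoV_fun (b : B) : A \Ox H :=
  \sw_(x, y <- urho (hautV b)) corestr cleft_proj_coinv x \ox y.

Lemma cleft_isoV_linear : linear cleft_isoV_fun.
Proof. rewrite /cleft_isoV_fun; lin. Qed.

Lemma cleft_isoK : cancel cleft_iso cleft_isoV_fun.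
Proof.
apply: tensor_ext => [||a h]; [|lin|].
  have L := cleft_isoV_linear.
  by move=> c x y; rewrite linearP L.
rewrite cleft_isoE /cleft_isoV_fun hmulE hautK urho_mul_gamma; [|lin..].
have E x : corestr cleft_proj_coinv (coinv_incl a *o gamma x) = hcounit x *: a.
  apply: coinv_incl_inj; rewrite linearZ /= -cleft_proj_mul.
  by rewrite coinv_inclE.
under eq_sw => x y do rewrite E tens_scalel.
by rewrite (counitl_sw h (f := fun y => a \ox y)) //; lin.
Qed.

Lemma cleft_isoVK : cancel cleft_isoV_fun cleft_iso.
Proof.
move=> b; rewrite -[RHS]hautVK -[X in _ = haut X]cleft_projK.
rewrite /cleft_isoV_fun !linear_sweedler; apply: eq_sw => x y.
by rewrite cleft_isoE hmulE coinv_inclE.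
Qed.

Lemma cleft_algebra :
  hom_algebra (crossed_mul cleft_act cleft_cocycle) (hone \ox hone).
Proof.
apply: hom_algebra_inj (can_inj cleft_isoK) _ _ _.
- exact: cleft_iso_haut.
- exact: cleft_isoM.
- exact: cleft_iso1.
Qed.

Definition cleft_crossed : crossedProduct A H :=
  CrossedProduct cleft_act_weak cleft_cocycle_inv cleft_algebra.

Lemma cleft_crossed_iso :
  exists (X : crossedProduct (coinv B) H) (f : {linear cprod X -> B}),
    [/\ bijective f,
        hom_algebra_map f,
        hom_module_map (cprod_act X) (coinv_act B) f
      & hom_comodule_map (cprod_coact X) hcoact f].
Proof.
exists cleft_crossed, (cleft_iso : {linear cprod cleft_crossed -> B}); split.
- exact: Bijective cleft_isoK cleft_isoVK.
- split; [exact: cleft_iso_haut | exact: cleft_isoM | exact: cleft_iso1].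
- split; first exact: cleft_iso_haut.
  move=> a m; move: m; apply: tensor_ext => [||b h]; [lin..|].
  rewrite cprod_actE coinv_actE !cleft_isoE.
  rewrite -coinv_inclE -[coinv_incl a in RHS](congr1 coinv_incl (hautVK a)).
  rewrite coinv_incl_haut hmulA -gammaE.
  by rewrite coinv_incl_hmul.
- split; first exact: cleft_iso_haut.
  apply: tensor_ext => [||a h]; [lin..|].
  rewrite cleft_isoE hmulE -urhoE cprod_coactE.
  rewrite sweedler_sw; [|lin..].
  rewrite -[LHS]sweedler_id urho_mul_gamma; [|lin..].
  rewrite udelta_sw; [|lin..]; apply: eq_sw => x y.
  rewrite sweedlerE; [|lin..].
  by rewrite cleft_isoE hmulE haut_umul -coinv_incl_haut hautVK gammaE.
Qed.

End CleftToCrossed.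

(** Since [gamma(1)] is invertible with inverse [gammaV(1)] and [gammaV(1)] is
    coinvariant, left multiplication by [gammaV(1)] makes the section unital;
    otherwise [a # h |-> a gamma(h)] would not preserve identities. *)
Lemma cleft_normalized (k : fieldType) (H : homHopfType k)
    (B : homComodAlgType H) :
  cleft B -> exists gamma gammaV : {linear H -> B},
    [/\ forall h, gamma (haut h) = haut (gamma h),
        urho \oL gamma = (tensl B H \oL gamma) *c tensr B H,
        cinv gamma gammaV & gamma hone = hone].
Proof.
move=> [gamma [/comodule_mapP[gE gD] [gammaV /conv_inverseP gK]]].
have d1 : udelta (hone : H) = hone \ox hone by rewrite udeltaE haut1 hcomul1.
have e1 := @hcounit1 k H.
have [gg' g'g] := gK.
have uv : gamma hone *o gammaV hone = hone.
  have := congr1 (fun f : {linear H -> B} => f hone) gg'.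
  by rewrite convE d1 sweedlerE /= ?e1 ?scale1r //; lin.
have vu : gammaV hone *o gamma hone = hone.
  have := congr1 (fun f : {linear H -> B} => f hone) g'g.
  by rewrite convE d1 sweedlerE /= ?e1 ?scale1r //; lin.
have gVE := cinv_equivariant gK gE.
(* The coaction sends gammaV 1 to gammaV 1 \ox S 1, and S 1 = 1. *)
have vD : urho (gammaV hone) = tensl B H (gammaV hone).
  have := congr1 (fun f : {linear H -> B \Ox H} => f hone) (urho_cinv gD gK).
  rewrite convE d1 sweedlerE /=; [|lin..].
  move=> ->.
  have S1 : antipode (hone : H) = hone.
    have := antipodel (hone : H); rewrite hcomul1 sweedlerE; [|lin..].
    rewrite hmulr1 e1 scale1r => E.
    by apply: (can_inj (@hautK k H)); rewrite E haut1.
  by rewrite S1 umul_tens !umul1r.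
exists (cst H (gammaV hone) *c gamma), (gammaV *c cst H (gamma hone)); split.
- move=> h; rewrite !conv_cstl gE haut_umul; congr (_ *o _).
  by rewrite -gVE haut1.
- rewrite !(lcomp_conv _ _ (ualg_urho B)) !(lcomp_conv _ _ (ualg_tensl B H)).
  by rewrite !lcomp_cst vD gD convA.
- by apply: cinvM gK; apply: cinv_cst.
- by rewrite conv_cstl.
Qed.

(** * Convolution invertibility as bijectivity *)

Section ConvolutionShift.
Variables (k : fieldType) (C : homCoalgType k) (A : homAlgType k).
Implicit Types s t : {linear C -> A}.

(** These operators turn convolution into composition, see [shift_conv]. *)
Definition shift_fun s (a : A) (c : C) : A \Ox C :=
  \sw_(x, y <- udelta c) (a *o s x) \ox y.

Lemma shift_linearl s c : linear ((shift_fun s)^~ c).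
Proof. rewrite /shift_fun; lin. Qed.

Lemma shift_linearr s a : linear (shift_fun s a).
Proof. rewrite /shift_fun; lin. Qed.

Definition shift s : {linear A \Ox C -> A \Ox C} :=
  tlift (shift_linearl s) (shift_linearr s).

Lemma shiftE s a c : shift s (a \ox c) = \sw_(x, y <- udelta c) (a *o s x) \ox y.
Proof. exact: tliftE. Qed.

Lemma shift_cst1 : shift (cst C hone) =1 id.
Proof.
apply: tensor_ext => [||a c]; [lin..|].
rewrite shiftE -[in RHS](udelta_counitl c) tens_swr; apply: eq_sw => x y.
by rewrite umulZr umulr1 tens_scalel tens_scaler.
Qed.

Lemma shift_conv s t : shift t \o shift s =1 shift (s *c t).
Proof.
apply: tensor_ext => [||a c]; [lin..|].
rewrite /= !shiftE linear_sweedler.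
under eq_sw => x y do rewrite shiftE.
rewrite (coassoc_sw c (f := fun x z w => ((a *o s x) *o t z) \ox w)
  (ucomodule_udelta C)); [|lin..].
apply: eq_sw => x y; rewrite convE tens_swr linear_sweedler tens_swl.
by apply: eq_sw => z w; rewrite umulA.
Qed.

(** A map is recovered from its shift by applying the counit at the unit of
    [A], so [shift] is injective. *)
Lemma shift_counit s c :
  \sw_(x, y <- shift s (hone \ox c)) hcounit y *: x = s c.
Proof.
rewrite shiftE sweedler_sw; [|lin..].
rewrite -(counitr_sw c (f := s)); last by lin.
by apply: eq_sw => x y; rewrite sweedlerE ?umul1r //; lin.
Qed.

Lemma shift_inj s t : shift s =1 shift t -> s = t.
Proof.
by move=> E; apply: linear_ext => c; rewrite -shift_counit E shift_counit.
Qed.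

Lemma shift_cancel s t : cinv s t -> cancel (shift s) (shift t).
Proof. by move=> [st _] u; rewrite -[LHS]/((_ \o _) u) shift_conv st shift_cst1. Qed.

Lemma cinv_shift_bij s t : cinv s t -> bijective (shift s).
Proof.
by move=> st; exists (shift t); apply: shift_cancel => //; apply: cinv_sym.
Qed.

Lemma left_mul_linear (a : A) : linear (fun b : A => a *o b).
Proof. lin. Qed.

(** If [th] is the inverse of [shift s] then [t c := (id \Ox counit) (th (1 \ox c))]
    is a right inverse of [s], because [th] is left [A]-linear like [shift s]:
    [s(c_1) t(c_2)] is the counit applied to
    [th (s(c_1) \ox c_2) = th (shift s (1 \ox c))]. Then
    [shift (t * s)] composed with [shift s] is [shift (s * t * s) = shift s], and
    surjectivity of [shift s] gives [t * s = 1]. *)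
Lemma shift_bij_cinv s : bijective (shift s) -> exists t, cinv s t.
Proof.
move=> [th thK Kth].
have th_lin : linear th := can2_linear thK Kth.
have t_lin : linear (fun c => \sw_(x, y <- th (hone \ox c)) hcounit y *: x : A).
  apply: linear_sw; [lin..|].
  by move=> c u v; rewrite -th_lin; congr th; apply: (tens_bilinear A C).2.
pose t : {linear C -> A} := mklin t_lin.
have st : s *c t = cst C hone.
  pose th' : {linear A \Ox C -> A \Ox C} := mklin th_lin.
  pose L a : {linear A \Ox C -> A \Ox C} :=
    tmap (mklin (left_mul_linear a)) idfun.
  have LE a b c : L a (b \ox c) = (a *o b) \ox c by rewrite tmapE.
  have shiftL a u : shift s (L a u) = L a (shift s u).
    move: u; apply: tensor_ext => [||b c]; [lin..|].
    rewrite LE !shiftE linear_sweedler; apply: eq_sw => x y.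
    by rewrite LE umulA.
  have thL a u : th (L a u) = L a (th u).
    by apply: (can_inj thK); rewrite Kth shiftL Kth.
  have cL a u : \sw_(x, y <- L a u) hcounit y *: x
      = a *o (\sw_(x, y <- u) hcounit y *: x).
    move: u; apply: tensor_ext => [||b c]; [lin..|].
    by rewrite LE !sweedlerE ?umulZr //; lin.
  apply: linear_ext => c; rewrite convE.
  transitivity (\sw_(x, y <- th (shift s (hone \ox c))) hcounit y *: x); last first.
    by rewrite thK sweedlerE //; lin.
  rewrite shiftE -[th]/(th' : _ -> _) linear_sweedler sweedler_sw; [|lin..].
  apply: eq_sw => x y; rewrite umul1r /= -[in RHS](umulr1 (s x)) -LE thL cL.
  by [].
have ts : t *c s = cst C hone.
  apply: shift_inj => u; rewrite shift_cst1 -[u]Kth.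
  rewrite -[LHS]/((_ \o _) _) shift_conv convA st conv1f.
  by [].
by exists t.
Qed.

End ConvolutionShift.

(** * From a crossed product to a cleft extension *)

Section CrossedToCleft.
Variables (k : fieldType) (H : homHopfType k) (B : homComodAlgType H).
Local Notation A := (coinv B).
Variables (X : crossedProduct A H) (f : {linear cprod X -> B}).
Hypothesis f_bij : bijective f.
Hypothesis fM : hom_algebra_map f.
Hypothesis fA : hom_module_map (cprod_act X) (coinv_act B) f.
Hypothesis fH : hom_comodule_map (cprod_coact X) hcoact f.

Let fE (t : cprod X) : f (haut t) = haut (f t). Proof. by case: fM. Qed.

Lemma section_linear : linear (fun h : H => hautV (f ((hone : A) \ox h)) : B).
Proof.
have l : linear (fun h : H => (hone : A) \ox h) by lin.
by move=> c x y; rewrite l !linearP.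
Qed.

(** [hautV] untwists the given isomorphism: [hautV o f] sends [a \ox h] to the
    ordinary product [a *o gamma h]. *)
Definition crossed_section : {linear H -> B} := locked (mklin section_linear).

Local Notation gamma := crossed_section.

Lemma crossed_sectionE h : f ((hone : A) \ox h) = haut (gamma h).
Proof. by rewrite /crossed_section; unlock; rewrite /= hautVK. Qed.

Lemma crossed_section_haut h : gamma (haut h) = haut (gamma h).
Proof.
apply: (can_inj (@hautK k B)); rewrite -!crossed_sectionE -fE.
by rewrite -[in LHS]haut1 -haut_tens.
Qed.

Lemma crossed_isoE (a : A) h : f (a \ox h) = haut (coinv_incl a *o gamma h).
Proof.
have := fA.2 a ((hone : A) \ox hautV h).
rewrite cprod_actE coinv_actE hmulr1 !hautVK => ->.
by rewrite crossed_sectionE -crossed_section_haut hautVK hmulE coinv_inclE.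
Qed.

Lemma crossed_section_comodule : hom_comodule_map hcomul hcoact gamma.
Proof.
split=> [|h]; first exact: crossed_section_haut.
have -> : gamma h = f ((hone : A) \ox hautV h).
  by rewrite crossed_sectionE -crossed_section_haut hautVK.
rewrite fH.2 cprod_coactE sweedler_sw; [|lin..].
rewrite -[in RHS](hautVK h) hcomul_sw; [|lin..].
apply: eq_sw => x y; rewrite sweedlerE; [|lin..].
by rewrite hautV1 crossed_sectionE crossed_section_haut.
Qed.

(** The cocycle of the untwisted multiplication of the crossed product. *)
Definition crossed_sigma : {linear H \Ox H -> A} :=
  haut \oL (cp_cocycle X \oL (hautV \oL hautV)).

Lemma crossed_sigma_inv : exists s, cinv crossed_sigma s.
Proof.
have [s /conv_inverse2P/conv_inverseP sP] := cp_cocycleP X.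
exists (haut \oL (s \oL (hautV \oL hautV))).
apply: cinv_lcomp (ualg_haut _) _.
rewrite !lcompA; apply: lcomp_cinv (ucoalg_hautV _) _.
exact: lcomp_cinv (ucoalg_hautV _) _.
Qed.

(** The product [(1 # g)(1 # h)]. As [g_1] acts on the identity by the counit,
    only the cocycle and the product of [H] remain. *)
Lemma crossed_section_mul g h :
  gamma g *o gamma h
  = \sw_(g1, g2 <- udelta g) \sw_(h1, h2 <- udelta h)
      coinv_incl (crossed_sigma (g1 \ox h1)) *o gamma (g2 *o h2).
Proof.
have [_ /(_ ((hone : A) \ox g) ((hone : A) \ox h)) fMgh _] := fM.
rewrite !crossed_sectionE hmulE -haut_umul in fMgh.
apply: (can_inj (@hautK k B)); apply: (can_inj (@hautK k B)); rewrite -{}fMgh.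
(* A summand of the crossed product (1 # g)(1 # h), with x the first component
   of g and c the value of the cocycle. *)
have termE x c z w : f ((hone *h (cp_act X (hautV x \ox hautV (hautV hone)) *h c))
      \ox (z *h w))
    = hcounit x *: haut (haut (coinv_incl (haut c) *o gamma (z *o w))).
  have [_ act1 _] := cp_actP X.
  rewrite !hautV1 act1 -[hcounit x](congr1 hcounit (hautVK x)) hcounit_haut.
  rewrite tens_scalel linearZ /= hmul1r hmul1r linearZ.
  rewrite crossed_isoE hmulE crossed_section_haut.
  by rewrite !(linearZ, coinv_incl_haut, haut_umul) /= umulZl.
transitivity (\sw_(x, g' <- udelta g) hcounit x *:
  haut (haut (\sw_(g1, g2 <- udelta g') \sw_(h1, h2 <- udelta h)
    coinv_incl (crossed_sigma (g1 \ox h1)) *o gamma (g2 *o h2)))); last first.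
  by rewrite counitl_sw //; lin.
rewrite cprod_mulE crossed_mulE linear_sweedler udelta_sw; [|lin..].
apply: eq_sw => x y.
rewrite udelta_haut; [|lin..].
rewrite udelta_sw; [|lin..].
rewrite !linear_sweedler; apply: eq_sw => g1 g2.
rewrite udelta_sw; [|lin..].
rewrite !linear_sweedler; apply: eq_sw => h1 h2.
rewrite termE hcounit_haut /crossed_sigma /= !hautV_tens !hautK.
by [].
Qed.

(** [J] identifies [A \Ox (H \Ox H)] with [B \Ox H]. Under it [shift gamma]
    becomes [K o shift crossed_sigma], where [K] is [g \ox h |-> g h_1 \ox h_2] on
    the last two factors, and both maps are bijective. *)
Lemma crossed_section_inv : exists gammaV, cinv gamma gammaV.
Proof.
apply: shift_bij_cinv.
have [s sP] := crossed_sigma_inv.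
pose f0 : {linear A \Ox H -> B} := hautV \o f.
have f0_bij : bijective f0.
  by apply: bij_comp f_bij; exists haut; [apply: hautVK | apply: hautK].
have f0E (a : A) h : f0 (a \ox h) = coinv_incl a *o gamma h.
  by rewrite /f0 /= crossed_isoE hautK.
have [J JE J_bij] := bij_assoc_tens H f0_bij.
pose K := tmap (lid A) (shift (lid H)).
have K_bij : bijective K.
  have S := cinv_antipode H.
  exists (tmap (lid A) (shift antipode)); apply: tensor_ext => [||a t];
    try lin; rewrite !tmapE shift_cancel //; exact: cinv_sym.
have E : shift gamma \o J =1 J \o (K \o shift crossed_sigma).
  apply: tensor_ext => [||a]; [lin..|].
  apply: tensor_ext => [||g h]; [lin..|].
  rewrite /comp JE f0E !shiftE.
  transitivity (\sw_(x, y <- udelta h) \sw_(z, w <- udelta x)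
      \sw_(g1, g2 <- udelta g)
        (coinv_incl a *o
          (coinv_incl (crossed_sigma (g1 \ox z)) *o gamma (g2 *o w))) \ox y).
    apply: eq_sw => x y; rewrite -umulA crossed_section_mul exchange_sw.
    rewrite tens_swr linear_sweedler tens_swl; apply: eq_sw => z w.
    by rewrite tens_swr linear_sweedler tens_swl.
  rewrite -(coassoc_sw h (f := fun x z w => \sw_(g1, g2 <- udelta g)
      (coinv_incl a *o
        (coinv_incl (crossed_sigma (g1 \ox x)) *o gamma (g2 *o z))) \ox w)
    (ucomodule_udelta H)); [|lin..].
  rewrite udelta_tens_sw; [|lin..].
  rewrite -[RHS]/((J \oL K) _) exchange_sw linear_sweedler.
  apply: eq_sw => x y; rewrite exchange_sw linear_sweedler.
  apply: eq_sw => g1 g2; rewrite -[(J \oL K) _]/(J (K _)) tmapE shiftE.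
  rewrite tens_swr linear_sweedler; apply: eq_sw => z w.
  have [inclM _] := ualg_coinv_incl B.
  by rewrite JE f0E inclM umulA.
have [J' JK J'K] := J_bij.
have J'_bij : bijective J' by exists J.
apply: (eq_bij (f := (J \o (K \o shift crossed_sigma)) \o J')).
  apply: bij_comp J'_bij; apply: (bij_comp J_bij).
  exact: bij_comp K_bij (cinv_shift_bij sP).
by move=> u; rewrite -[LHS]/((J \o (K \o shift crossed_sigma)) (J' u)) -E /= J'K.
Qed.

Lemma crossed_cleft : cleft B.
Proof.
exists gamma; split; first exact: crossed_section_comodule.
by have [s sP] := crossed_section_inv; exists s; apply/conv_inverseP.
Qed.

End CrossedToCleft.

(** * The equivalence *)

Theorem theorem4p5 (k : fieldType) (H : homHopfType k) (B : homComodAlgType H) :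
  cleft B <->
  exists (X : crossedProduct (coinv B) H) (f : {linear cprod X -> B}),
    [/\ bijective f,
        hom_algebra_map f,
        hom_module_map (cprod_act X) (coinv_act B) f
      & hom_comodule_map (cprod_coact X) hcoact f].
Proof.
split=> [/cleft_normalized[gamma [gammaV [gE gD gK g1]]] | [X [f [f_bij fM fA fH]]]].
  exact: cleft_crossed_iso gE gD gK g1.
exact: crossed_cleft f_bij fM fA fH.
Qed.
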